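(* Let $n\geq3$ and let $\Omega\subset\mathbb{R}^n$ be a bounded domain with smooth boundary. Let $u$ be the electrostatic potential of $\Omega$ and let $\operatorname{Crit}(u)$ denote the set of critical points of $u$. Let $\beta\geq0$ and set $$a_\beta=\frac{\beta}{4}\left(\beta-\frac{n-2}{n-1}\right).$$ Let $c,d\in\mathbb{R}$ be fixed constants satisfying $c+d\geq0$ and $d\geq0$, and define smooth functions $F,G\colon(0,1]\to\mathbb{R}$ by $$F(u)=(cu+d)\,u^{1-\frac{n-1}{n-2}\beta},\qquad G(u)=-\frac{(n-1)\beta}{(n-2)u}F(u)+d\,u^{-\frac{n-1}{n-2}\beta}.$$ Then $$\operatorname{div}\left(F(u)D|Du|^{\beta}+G(u)|Du|^{\beta}Du\right)\;\geq\;a_\beta\,F(u)\left|D|Du|^2-\frac{2(n-1)|Du|^2Du}{(n-2)u}\right|^2|Du|^{\beta-4}$$ holds on $\mathbb{R}^n\setminus(\overline{\Omega}\cup\operatorname{Crit}(u))$. Moreover, if $\beta\geq\frac{n-2}{n-1}$, then $$|Du|^2\operatorname{div}\left(F(u)D|Du|^{\beta}+G(u)|Du|^{\beta}Du\right)\geq0$$ holds on $\mathbb{R}^n\setminus(\overline{\Omega}\cup\operatorname{Crit}(u))$, with equality if and only if $\Omega$ is a round ball (unless $c=d=0$).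
   Context: The electrostatic potential of $\Omega$ is the unique smooth function $u\colon\mathbb{R}^n\setminus\Omega\to\mathbb{R}$ with $\Delta u=0$ in $\mathbb{R}^n\setminus\overline{\Omega}$, $u=1$ on $\partial\Omega$, and $u(x)\to0$ as $|x|\to\infty$. $D$ denotes the Euclidean gradient and $\operatorname{div}$ the Euclidean divergence. In the inequalities, $F(u)$ and $G(u)$ denote the compositions of $F$ and $G$ with the potential. Equality in the last inequality is meant on the whole set $\mathbb{R}^n\setminus(\overline{\Omega}\cup\operatorname{Crit}(u))$.
   Formalization: For ''equality only if Ω is a round ball'', the complement of the closure of Ω is additionally assumed connected; without this the claim fails, e.g. for the shell 1<|x|<2, where u=1 in the hole and u is radial outside. *)

(* Defs.v *)
From HB Require Import structures.
From mathcomp Require Import all_boot all_order all_algebra.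
From mathcomp Require Import all_classical all_reals all_analysis.

Set Implicit Arguments.
Unset Strict Implicit.
Unset Printing Implicit Defensive.

Import Order.TTheory GRing.Theory Num.Theory.
Import numFieldNormedType.Exports.

Local Open Scope classical_set_scope.
Local Open Scope ring_scope.

(* R^n is 'rV[R]_n.  Its library norm `|x| is the sup norm, which gives the
   usual topology, bounded sets and derivatives; lengths must use [enorm]. *)
Definition enorm (R : realType) (n : nat) (x : 'rV[R]_n) : R :=
  Num.sqrt (\sum_(i < n) x ord0 i ^+ 2).

Definition partial (R : realType) (n : nat) (i : 'I_n) (f : 'rV[R]_n -> R)
    (x : 'rV[R]_n) : R :=
  'D_(delta_mx ord0 i) f x.

Definition grad (R : realType) (n : nat) (f : 'rV[R]_n -> R)
    (x : 'rV[R]_n) : 'rV[R]_n :=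
  \row_(i < n) partial i f x.

Definition divergence (R : realType) (n : nat) (X : 'rV[R]_n -> 'rV[R]_n)
    (x : 'rV[R]_n) : R :=
  \sum_(i < n) partial i (fun y => X y ord0 i) x.

Definition laplacian (R : realType) (n : nat) (f : 'rV[R]_n -> R)
    (x : 'rV[R]_n) : R :=
  \sum_(i < n) partial i (partial i f) x.

(* Meaningful for U open. *)
Fixpoint is_Ck (R : realType) (n k : nat) (U : set 'rV[R]_n)
    (f : 'rV[R]_n -> R) : Prop :=
  match k with
  | 0 => forall x, U x -> {for x, continuous f}
  | k'.+1 => (forall x, U x -> differentiable f x) /\
             (forall i : 'I_n, is_Ck k' U (partial i f))
  end.

Definition smooth_on_open (R : realType) (n : nat) (U : set 'rV[R]_n)
    (f : 'rV[R]_n -> R) : Prop :=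
  forall k, is_Ck k U f.

(* Smoothness on an arbitrary set S, as usual: f coincides on S, near each of
   its points, with a smooth function on an open set.  The values of f off S
   are irrelevant. *)
Definition smooth_on (R : realType) (n : nat) (S : set 'rV[R]_n)
    (f : 'rV[R]_n -> R) : Prop :=
  forall x, S x -> exists (U : set 'rV[R]_n) (g : 'rV[R]_n -> R),
    [/\ open U, U x, smooth_on_open U g & forall y, U y -> S y -> f y = g y].

Definition boundary (R : realType) (n : nat) (A : set 'rV[R]_n) :
    set 'rV[R]_n :=
  closure A `\` interior A.

Definition bounded_domain (R : realType) (n : nat) (Omega : set 'rV[R]_n) :
    Prop :=
  [/\ open Omega, Omega !=set0, connected Omega & bounded_set Omega].

(* Near each boundary point Omega is the sublevel set {rho < 0} of a smooth
   local defining function rho without critical points. *)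
Definition smooth_boundary (R : realType) (n : nat) (Omega : set 'rV[R]_n) :
    Prop :=
  forall p, boundary Omega p ->
    exists (U : set 'rV[R]_n) (rho : 'rV[R]_n -> R),
      [/\ open U, U p, smooth_on_open U rho,
          (forall x, U x -> grad rho x != 0) &
          (forall x, U x -> (Omega x <-> rho x < 0))].

(* The potential u : R^n \ Omega -> R is represented by a total function whose
   values in Omega are irrelevant. *)
Definition electrostatic_potential (R : realType) (n : nat)
    (Omega : set 'rV[R]_n) (u : 'rV[R]_n -> R) : Prop :=
  [/\ smooth_on (~` Omega) u,
      (forall x, (~` closure Omega) x -> laplacian u x = 0),
      (forall x, boundary Omega x -> u x = 1) &
      (forall e : R, 0 < e -> exists M : R,
         forall x, (~` Omega) x -> M < enorm x -> `|u x| < e)].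

(* Only used at points off the closure of Omega, where [grad u] is a genuine
   gradient. *)
Definition Crit (R : realType) (n : nat) (u : 'rV[R]_n -> R) :
    set 'rV[R]_n :=
  [set x | grad u x = 0].

Definition round_ball (R : realType) (n : nat) (A : set 'rV[R]_n) : Prop :=
  exists (p : 'rV[R]_n) (r : R), 0 < r /\ A = [set x | enorm (x - p) < r].

Definition a_coef (R : realType) (n : nat) (beta : R) : R :=
  beta / 4 * (beta - (n%:R - 2) / (n%:R - 1)).

Definition Ffun (R : realType) (n : nat) (beta c d t : R) : R :=
  (c * t + d) * t `^ (1 - (n%:R - 1) / (n%:R - 2) * beta).

Definition Gfun (R : realType) (n : nat) (beta c d t : R) : R :=
  - (((n%:R - 1) * beta) / ((n%:R - 2) * t)) * Ffun n beta c d t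
  + d * t `^ (- ((n%:R - 1) / (n%:R - 2) * beta)).

(* F(u) D|Du|^beta + G(u) |Du|^beta Du *)
Definition flux (R : realType) (n : nat) (beta c d : R)
    (u : 'rV[R]_n -> R) (x : 'rV[R]_n) : 'rV[R]_n :=
  Ffun n beta c d (u x) *: grad (fun y => enorm (grad u y) `^ beta) x
  + (Gfun n beta c d (u x) * enorm (grad u x) `^ beta) *: grad u x.

(* D|Du|^2 - 2 (n-1) |Du|^2 Du / ((n-2) u) *)
Definition defect (R : realType) (n : nat) (u : 'rV[R]_n -> R)
    (x : 'rV[R]_n) : 'rV[R]_n :=
  grad (fun y => enorm (grad u y) ^+ 2) x
  - ((2 * (n%:R - 1) * enorm (grad u x) ^+ 2) / ((n%:R - 2) * u x))
      *: grad u x.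

(* Main.v *)
(* Write w = |Du|^2, b = D^2u Du and e = Du / |Du|.  Expanding the divergence and
   using that u is harmonic, all terms that are not quadratic in the Hessian
   combine exactly into the square of [defect], and the remainder is
     beta F w^(beta/2 - 1) (|D^2u|^2 - n / (n - 1) |b|^2 / w),
   which is nonnegative by the refined Kato inequality; F >= 0 because
   0 <= u <= 1 by the maximum principle.

   On the exterior of a ball u = (r / |x - p|)^(n - 2), for which both [defect]
   and the Kato deficit vanish.  Conversely, equality forces the Kato deficit to
   vanish, i.e. D^2u = lam (I - n e (x) e).  Since D^2u is the Hessian of a
   harmonic function, D lam = - n lam^2 Du / w, so that lam^(2n-2) / w^n,
   x - Du / lam and u + w / ((n - 2) lam) are locally constant off Crit u.
   These constants bound |Du| from below, so on the connected exterior there are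
   no critical points and u = a |x - p|^(2 - n).  Hence the boundary of Omega
   lies on a sphere around p, and following rays out of Omega shows that Omega
   is the ball. *)
Require Import Defs.
From HB Require Import structures.
From mathcomp Require Import all_boot all_order all_algebra.
From mathcomp Require Import all_classical all_reals all_analysis.
From mathcomp Require Import ring lra.

Set Implicit Arguments.
Unset Strict Implicit.
Unset Printing Implicit Defensive.

Import Order.TTheory GRing.Theory Num.Theory.
Import numFieldNormedType.Exports.

Local Open Scope classical_set_scope.
Local Open Scope ring_scope.

Lemma differentiable_near (R : realType) (V W : normedModType R) (f g : V -> W) x :
  (\forall y \near x, f y = g y) -> differentiable f x -> differentiable g x.
Proof.
move=> e /diff_locallyP[dc dE].
have E : g \o shift x = cst (g x) + 'd f x +o_ 0 id.
  apply: eqaddoE; apply/eqaddoP => _/posnumP[eps].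
  move: dE => /eqaddoP/(_ eps%:num ltac:(by [])) h.
  have e0 : \forall h \near 0, f (h + x) = g (h + x).
    by move: e; rewrite (near_shift 0 x) /= subr0.
  near=> k.
  have -> : ((g \o shift x) - (cst (g x) + 'd f x)) k = ((f \o shift x) - (cst (f x) + 'd f x)) k.
    rewrite /= -[LHS]/(g (k + x) - (g x + 'd f x k)) -[RHS]/(f (k + x) - (f x + 'd f x k)).
    by rewrite (nbhs_singleton e) (near e0 k).
  near: k; exact: h.
by apply/diff_locallyP; rewrite (diff_unique dc E).
Unshelve. all: by end_near. Qed.

Section Gradients.
Variables (R : realType) (n : nat).
Implicit Types (f g : 'rV[R]_n -> R) (x y v : 'rV[R]_n) (df dg : 'I_n -> R).

Definition hasgrad f x df :=
  differentiable f x /\ forall i, partial i f x = df i.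

Lemma hasgrad_partial f x :
  differentiable f x -> hasgrad f x (fun i => partial i f x).
Proof. by []. Qed.

Lemma hasgrad_eq f x df dg : hasgrad f x df -> df =1 dg -> hasgrad f x dg.
Proof. by move=> [? h] e; split=> // i; rewrite h. Qed.

Lemma hasgrad_cst (a : R) x : hasgrad (fun=> a) x (fun=> 0).
Proof.
split=> [|i]; first exact: differentiable_cst.
by rewrite /partial derive_cst.
Qed.

Lemma hasgrad_coord x (i : 'I_n) :
  hasgrad (fun y => y ord0 i) x (fun j => (i == j)%:R).
Proof.
split=> [|j]; first exact: differentiable_coord.
rewrite /partial deriveE; last exact: differentiable_coord.
pose phi := (fun N : 'rV[R]_n => N ord0 i : R).
have lphi : linear phi by move=> a ? ?; rewrite /phi !mxE.
pose lin := GRing.isLinear.Build _ _ _ _ _ lphi.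
pose phiL : {linear 'rV[R]_n -> R} := HB.pack phi lin.
have -> : (fun y : 'rV[R]_n => y ord0 i) = phiL by [].
rewrite diff_lin; first by rewrite /= /phi mxE eqxx.
exact: coord_continuous.
Qed.

Lemma hasgradD f g x df dg : hasgrad f x df -> hasgrad g x dg ->
  hasgrad (fun y => f y + g y) x (fun i => df i + dg i).
Proof.
move=> [d1 h1] [d2 h2]; split=> [|i]; first exact: differentiableD.
by rewrite /partial deriveD ?[X in X + _]h1 ?[X in _ + X]h2 //; exact: diff_derivable.
Qed.

Lemma hasgradN f x df : hasgrad f x df ->
  hasgrad (fun y => - f y) x (fun i => - df i).
Proof.
move=> [d1 h1]; split=> [|i]; first exact: differentiableN.
by rewrite /partial deriveN ?[X in - X]h1 //; exact: diff_derivable.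
Qed.

Lemma hasgradB f g x df dg : hasgrad f x df -> hasgrad g x dg ->
  hasgrad (fun y => f y - g y) x (fun i => df i - dg i).
Proof. by move=> h1 h2; apply: hasgradD => //; exact: hasgradN. Qed.

Lemma hasgradM f g x df dg : hasgrad f x df -> hasgrad g x dg ->
  hasgrad (fun y => f y * g y) x (fun i => df i * g x + f x * dg i).
Proof.
move=> [d1 h1] [d2 h2]; split=> [|i]; first exact: differentiableM.
rewrite /partial deriveM; [|exact: diff_derivable..].
by rewrite -[X in _ *: X + _]/(partial i g x) -[X in _ + _ *: X]/(partial i f x)
  h1 h2 addrC mulrC.
Qed.

Lemma hasgradZ (a : R) f x df : hasgrad f x df ->
  hasgrad (fun y => a * f y) x (fun i => a * df i).
Proof.
move=> h; apply: (hasgrad_eq (hasgradM (hasgrad_cst a x) h)) => i.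
by rewrite mul0r add0r.
Qed.

Lemma hasgrad_comp (phi : R -> R) (dphi : R) f x df :
  hasgrad f x df -> is_derive (f x) 1 phi dphi ->
  hasgrad (fun y => phi (f y)) x (fun i => dphi * df i).
Proof.
move=> [d1 h1] [dp hp].
have dp' : differentiable phi (f x) by apply/derivable1_diffP.
have dc : differentiable (phi \o f) x by exact: differentiable_comp.
split=> // i; rewrite /partial (deriveE _ dc) diff_comp //= deriv1E //.
by rewrite derive1E hp -deriveE // [X in X *: _](h1 i) mulrC.
Qed.

Lemma hasgradV f x df : f x != 0 -> hasgrad f x df ->
  hasgrad (fun y => (f y)^-1) x (fun i => - (f x) ^- 2 * df i).
Proof.
move=> f0 [d1 h1]; split=> [|i]; first exact: differentiableV.
by rewrite /partial deriveV //; [rewrite [X in _ *: X](h1 i)|exact: diff_derivable].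
Qed.

Lemma hasgradX f x df k : hasgrad f x df ->
  hasgrad (fun y => f y ^+ k) x (fun i => k%:R * f x ^+ k.-1 * df i).
Proof.
move=> h; apply: (hasgrad_comp (phi := fun t => t ^+ k) h).
split; first exact: exprn_derivable.
by rewrite exp_derive -[X in X = _]/(_ * _) mulr1.
Qed.

Lemma hasgrad_powR f x df (a : R) : 0 < f x -> hasgrad f x df ->
  hasgrad (fun y => f y `^ a) x (fun i => a * f x `^ (a - 1) * df i).
Proof.
move=> f0 h; apply: (hasgrad_comp (phi := fun t => t `^ a) h).
exact: is_derive1_powR.
Qed.

Lemma hasgrad_sum (I : Type) (r : seq I) (P : pred I)
    (F : I -> 'rV[R]_n -> R) (dF : I -> 'I_n -> R) x :
  (forall k, hasgrad (F k) x (dF k)) ->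
  hasgrad (fun y => \sum_(k <- r | P k) F k y) x
          (fun i => \sum_(k <- r | P k) dF k i).
Proof.
move=> h; elim: r => [|k r ih].
  have -> : (fun y => \sum_(k <- [::] | P k) F k y) = (fun=> 0).
    by apply/funext => y; rewrite big_nil.
  by apply: (hasgrad_eq (hasgrad_cst _ _)) => i; rewrite big_nil.
have -> : (fun y => \sum_(k <- k :: r | P k) F k y) =
          (fun y => (if P k then F k y else 0) + \sum_(k <- r | P k) F k y).
  by apply/funext => y; rewrite big_cons; case: ifP; rewrite ?add0r.
apply: (hasgrad_eq (df := fun i => (if P k then dF k i else 0)
    + \sum_(k <- r | P k) dF k i)).
  by apply: hasgradD => //; case: (P k) => //; exact: hasgrad_cst.
by move=> i; rewrite big_cons; case: ifP; rewrite ?add0r.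
Qed.

Lemma hasgrad_near f g x df : (\forall y \near x, f y = g y) ->
  hasgrad f x df -> hasgrad g x df.
Proof.
move=> e [d h]; split=> [|i]; first exact: differentiable_near d.
by rewrite /partial -(near_eq_derive _ e) -h.
Qed.

Lemma line_derive f x v (t : R) : differentiable f (t *: v + x) ->
  is_derive t 1 (fun s => f (s *: v + x)) ('D_v f (t *: v + x)).
Proof.
move=> /(@diff_derivable _ _ _ _ _ v) d.
have e : (fun h : R => h^-1 *: (((fun s => f (s *: v + x)) \o shift t) (h *: 1) - f (t *: v + x)))
   = (fun h => h^-1 *: ((f \o shift (t *: v + x)) (h *: v) - f (t *: v + x))).
  apply/funext => h /=.
  by rewrite [h *: 1]mulr1 scalerDl addrA.
by split; rewrite /derivable /derive e.
Qed.

Lemma derive_sum_partial f x v : differentiable f x ->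
  'D_v f x = \sum_i v ord0 i * partial i f x.
Proof.
move=> d; rewrite deriveE // {1}(row_sum_delta v) linear_sum.
by apply: eq_bigr => i _; rewrite linearZ /= -deriveE.
Qed.

End Gradients.

Lemma subr_swap (R : comPzRingType) (a b c d : R) :
  a - b - (c - d) = a - c - (b - d).
Proof. by ring. Qed.

Lemma dist_le_of_close (R : realType) (p q m m' eps : R) :
  `|p - m| < eps / 2 -> `|q - m'| < eps / 2 ->
  m' = m -> `|p - q| <= eps.
Proof.
move=> pm qm mm; rewrite [eps]splitr (le_trans (ler_distD m _ _)) //.
by rewrite lerD ?ltW // distrC -mm.
Qed.

Section LineCalculus.
Variables (R : realType) (n : nat).
Implicit Types (f g : 'rV[R]_n -> R) (x y z v : 'rV[R]_n).

Lemma continuous_line x v : continuous (fun t : R => t *: v + x).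
Proof.
move=> t; apply: cvgD; last exact: cvg_cst.
exact: scalel_continuous.
Qed.

Lemma line_mvt f x v (h : R) : 0 < h ->
  (forall t, 0 <= t <= h -> differentiable f (t *: v + x)) ->
  exists2 t, 0 < t < h &
    f (h *: v + x) - f x = h * 'D_v f (t *: v + x).
Proof.
move=> h0 df.
have [| |c] := @MVT R (fun s => f (s *: v + x)) (fun s => 'D_v f (s *: v + x)) 0 h h0.
- move=> t; rewrite in_itv /= => /andP[t0 th]; apply: line_derive.
  by apply: df; rewrite !ltW.
- apply: continuous_in_subspaceT => t; rewrite inE /= in_itv /= => th.
  apply: differentiable_continuous; apply/derivable1_diffP.
  by have [] := line_derive (df _ th).
rewrite in_itv /= => ch; rewrite scale0r add0r subr0 => e.
by exists c => //; rewrite e mulrC.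
Qed.

Lemma open_ball_sub (U : set 'rV[R]_n) x : open U -> U x ->
  exists2 e : R, 0 < e & forall y, `|x - y| < e -> U y.
Proof.
move=> oU Ux; have /nbhs_ballP[e /= e0 he] : nbhs x U by apply: open_nbhs_nbhs.
by exists e => // y hy; apply: he; rewrite -ball_normE.
Qed.

Lemma norm_delta (i : 'I_n) : `|delta_mx ord0 i : 'rV[R]_n| <= 1.
Proof.
rewrite [leLHS]mx_normrE; apply: bigmax_le => // -[k j] _ /=.
by rewrite mxE; case: (_ && _); rewrite ?normr1 ?normr0.
Qed.

Lemma double_mvt f x (i j : 'I_n) (h : R) : 0 < h ->
  (forall y, `|x - y| <= 2 * h -> differentiable f y /\
     differentiable (partial i f) y) ->
  let ei := delta_mx ord0 i in let ej := delta_mx ord0 j in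
  exists2 y, `|x - y| <= 2 * h &
   f (h *: ei + (h *: ej + x)) - f (h *: ej + x) - (f (h *: ei + x) - f x)
     = h * (h * partial j (partial i f) y).
Proof.
move=> h0 df ei ej.
have near_x s t : 0 <= s <= h -> 0 <= t <= h -> `|x - (s *: ei + (t *: ej + x))| <= 2 * h.
  move=> /andP[s0 sh] /andP[t0 th].
  have -> : x - (s *: ei + (t *: ej + x)) = - (s *: ei + t *: ej).
    by rewrite addrA opprD addrCA subrr addr0.
  rewrite normrN (le_trans (ler_normD _ _)) // !normrZ !ger0_norm //.
  have := norm_delta j; have := norm_delta i.
  rewrite -/ei -/ej => ei1 ej1; rewrite mulr2n mulrDl !mul1r.
  by apply: lerD; rewrite -[leRHS]mulr1 ler_pM.
pose g y := f (h *: ej + y) - f y.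
have hh : 0 <= h <= h by rewrite lexx ltW.
have h00 : 0 <= (0:R) <= h by rewrite lexx ltW.
have shiftD (y : 'rV[R]_n) : differentiable f (h *: ej + y) ->
    differentiable (fun z => f (h *: ej + z)) y.
  have ds : differentiable (fun z : 'rV[R]_n => h *: ej + z) y.
    by apply: differentiableD => //; exact: differentiable_cst.
  by move=> d; exact: (differentiable_comp (g := f) ds d).
have dg t : 0 <= t <= h -> hasgrad g (t *: ei + x)
    (fun k => partial k f (h *: ej + (t *: ei + x)) - partial k f (t *: ei + x)).
  move=> th; apply: (@hasgradB R n (fun y => f (h *: ej + y)) f); last first.
    apply: hasgrad_partial; have [] // := df (t *: ei + x).
    by have := near_x t 0 th h00; rewrite scale0r add0r.
  have d : differentiable f (h *: ej + (t *: ei + x)).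
    by have [] // := df (h *: ej + (t *: ei + x)); rewrite addrCA near_x.
  split=> [|k]; first exact: shiftD.
  have e : (fun s : R => s^-1 *: (((fun z => f (h *: ej + z)) \o shift (t *: ei + x))
        (s *: delta_mx ord0 k) - f (h *: ej + (t *: ei + x)))) =
      (fun s => s^-1 *: ((f \o shift (h *: ej + (t *: ei + x)))
        (s *: delta_mx ord0 k) - f (h *: ej + (t *: ei + x)))).
    by apply/funext => s /=; rewrite addrCA.
  by rewrite /partial /derive e.
have [t ht e1] := @line_mvt g x ei h h0 (fun t ht => (dg t ht).1).
have ht' : 0 <= t <= h by case/andP: ht => *; rewrite !ltW.
move: e1; rewrite -[X in h * X]/(partial i g _) (dg t ht').2.
have [|s hs e2] := @line_mvt (partial i f) (t *: ei + x) ej h h0.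
  by move=> s hs; have [] // := df (s *: ej + (t *: ei + x)); rewrite addrCA near_x.
rewrite e2 /g => e1.
exists (s *: ej + (t *: ei + x)).
  by rewrite addrCA near_x //; case/andP: hs => *; rewrite !ltW.
by rewrite -e1 subr_swap [h *: ej + (_ + _)]addrCA.
Qed.

End LineCalculus.

Lemma partialE (R : realType) (n : nat) (f : 'rV[R]_n -> R) x i :
  partial i f x = 'D_(delta_mx ord0 i) f x.
Proof. by []. Qed.

(* Otherwise failed unifications unfold derivatives down to filters. *)
#[local] Opaque derive partial.

Section LocalCalculus.
Variables (R : realType) (n : nat).
Implicit Types (f g : 'rV[R]_n -> R) (x y z v : 'rV[R]_n).

Lemma partialC (U : set 'rV[R]_n) f x (i j : 'I_n) : open U -> is_Ck 2 U f -> U x ->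
  partial i (partial j f) x = partial j (partial i f) x.
Proof.
move=> oU [df d2f] Ux.
have [e e0 he] := open_ball_sub oU Ux.
have close (a : 'I_n) (b : 'I_n) eps : 0 < eps -> exists2 d, 0 < d & forall y, `|x - y| < d ->
    `|partial a (partial b f) x - partial a (partial b f) y| < eps.
  move=> eps0; have [_ /(_ a) c] := d2f b.
  have /cvgrPdist_lt/(_ _ eps0)/nbhs_ballP[d /= d0 hd] := c x Ux.
  by exists d => // y hy; apply: hd; rewrite -ball_normE.
apply/eqP; rewrite -subr_eq0 -normr_le0; apply/ler_addgt0Pl => eps eps0; rewrite addr0.
have eps2 : 0 < eps / 2 by rewrite divr_gt0.
have [d1 d10 h1] := close i j _ eps2; have [d2 d20 h2] := close j i _ eps2.
pose h := Num.min e (Num.min d1 d2) / 4.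
have m0 : 0 < Num.min e (Num.min d1 d2) by rewrite !lt_min e0 d10.
have h0 : 0 < h by rewrite divr_gt0.
have hlt : 2 * h < Num.min e (Num.min d1 d2) by rewrite /h; lra.
have [he1 hd1 hd2] : [/\ 2 * h < e, 2 * h < d1 & 2 * h < d2].
  by move: hlt; rewrite !lt_min => /andP[-> /andP[-> ->]].
have D a y : `|x - y| <= 2 * h -> differentiable f y /\ differentiable (partial a f) y.
  move=> hy; have Uy : U y by apply: he; exact: le_lt_trans hy _.
  by split; [exact: df|have [d _] := d2f a; exact: d].
have [y1 hy1 e1] := @double_mvt R n f x i j h h0 (D i).
have [y2 hy2 e2] := @double_mvt R n f x j i h h0 (D j).
have : partial j (partial i f) y1 = partial i (partial j f) y2.
  have hn : h != 0 by rewrite gt_eqF.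
  have E := addrCA (h *: delta_mx ord0 j) (h *: delta_mx ord0 i) x.
  move: e1 e2; rewrite E => e1 e2.
  apply: (mulfI hn); apply: (mulfI hn); apply: etrans e2.
  by rewrite -e1; apply: subr_swap.
move=> ey.
exact: (dist_le_of_close (h1 y2 (le_lt_trans hy2 hd1)) (h2 y1 (le_lt_trans hy1 hd2)) ey).
Qed.

Lemma ball_constant f x (e : R) :
  (forall y, `|x - y| < e -> hasgrad f y (fun=> 0)) ->
  forall y, `|x - y| < e -> f y = f x.
Proof.
move=> h y hy.
have hb t : 0 <= t <= 1 -> `|x - (t *: (y - x) + x)| < e.
  move=> /andP[t0 t1].
  rewrite opprD addrCA subrr addr0 normrN normrZ ger0_norm // distrC.
  by apply: le_lt_trans hy; rewrite ler_piMl.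
have [t /andP[t0 t1]] := @line_mvt R n f x (y - x) 1 ltr01 (fun t ht => (h _ (hb t ht)).1).
rewrite scale1r subrK => /eqP; rewrite subr_eq => /eqP ->.
have ht : 0 <= t <= 1 by rewrite !ltW.
have [d p] := h _ (hb t ht).
rewrite derive_sum_partial // big1 ?mulr0 ?add0r // => k _.
by rewrite p mulr0.
Qed.

Lemma norm_line (i : 'I_n) x (t : R) :
  `|x - (t *: delta_mx ord0 i + x)| <= `|t|.
Proof.
rewrite opprD addrCA subrr addr0 normrN normrZ.
by rewrite ler_piMr // norm_delta.
Qed.

Lemma local_max_partial (U : set 'rV[R]_n) f x (i : 'I_n) : open U -> U x ->
  (forall y, U y -> differentiable f y) ->
  (\forall y \near x, f y <= f x) -> partial i f x = 0.
Proof.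
move=> oU Ux df /nbhs_ballP[e1 /= e10 h1].
have [e e0 he] := open_ball_sub oU Ux.
pose d := Num.min e e1.
have d0 : 0 < d by rewrite lt_min e0.
have hd t : t \in `](- d), d[%R ->
    `|x - (t *: delta_mx ord0 i + x)| < e /\ `|x - (t *: delta_mx ord0 i + x)| < e1.
  rewrite in_itv /= -ltr_norml lt_min => /andP[? ?].
  by split; apply: le_lt_trans (norm_line _ _ _) _.
have z0 : 0 \in `](- d), d[%R by rewrite in_itv /= oppr_lt0 d0.
have [| | | |_ e3] := @derive1_at_max R (fun t => f (t *: delta_mx ord0 i + x)) (- d) d 0.
- by rewrite ge0_cp // ltW.
- move=> t /hd[ht _].
  by have [] := line_derive (df _ (he _ ht)).
- exact: z0.
- move=> t /hd[_ ht]; rewrite scale0r add0r; apply: h1.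
  by rewrite -ball_normE.
have dx : differentiable f (0 *: delta_mx ord0 i + x).
  by rewrite scale0r add0r; exact: df.
have [_ e2] := line_derive (v := delta_mx ord0 i) dx.
by move: e2; rewrite e3 partialE scale0r add0r => <-.
Qed.

Lemma local_max_partial2 (U : set 'rV[R]_n) f x (i : 'I_n) : open U -> U x ->
  (forall y, U y -> differentiable f y) -> differentiable (partial i f) x ->
  (\forall y \near x, f y <= f x) -> partial i (partial i f) x <= 0.
Proof.
move=> oU Ux df dpf hmax; rewrite leNgt; apply/negP => L0.
have p0 := local_max_partial i oU Ux df hmax.
move: hmax => /nbhs_ballP[e1 /= e10 h1].
have [e e0 he] := open_ball_sub oU Ux.
have /(@diff_derivable _ _ _ _ _ (delta_mx ord0 i)) dp := dpf.
have : \forall h \near (0 : R)^',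
    0 < h^-1 *: ((partial i f \o shift x) (h *: delta_mx ord0 i) - partial i f x).
  move: dp; rewrite /derivable => dp.
  have dp' : (fun h : R => h^-1 *: ((partial i f \o shift x) (h *: delta_mx ord0 i)
      - partial i f x)) @ (0 : R)^' --> partial i (partial i f) x by exact: dp.
  by move: dp' => /cvgr_gt/(_ _ L0).
case/nbhs_ballP => d /= d0 hd.
pose h := Num.min d (Num.min e e1) / 2.
have m0 : 0 < Num.min d (Num.min e e1) by rewrite !lt_min d0 e0.
have h0 : 0 < h by rewrite divr_gt0.
have : h < Num.min d (Num.min e e1) by rewrite /h; lra.
rewrite !lt_min => /andP[hhd /andP[hhe hhe1]].
have [|t /andP[t0 th]] := @line_mvt R n f x (delta_mx ord0 i) h h0.
  move=> t /andP[t0 th]; apply: df; apply: he.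
  by apply: le_lt_trans (norm_line _ _ _) _; rewrite ger0_norm // (le_lt_trans th).
have : 0 < partial i f (t *: delta_mx ord0 i + x).
  have := hd t; rewrite /= p0 subr0 -ball_normE /= sub0r normrN gtr0_norm //.
  move=> /(_ (lt_trans th hhd) (lt0r_neq0 t0)).
  by rewrite [_ *: _]/(_ * _) pmulr_rgt0 // invr_gt0.
rewrite partialE => hp ef.
have : f (h *: delta_mx ord0 i + x) <= f x.
  apply: h1; rewrite -ball_normE /=.
  by apply: le_lt_trans (norm_line _ _ _) _; rewrite gtr0_norm.
by rewrite -subr_le0 ef pmulr_rle0 // leNgt hp.
Qed.
End LocalCalculus.

Section Smoothness.
Variables (R : realType) (n : nat).
Implicit Types (f g : 'rV[R]_n -> R) (x y z v : 'rV[R]_n) (U V : set 'rV[R]_n).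

Lemma near_open U (P : 'rV[R]_n -> Prop) x : open U -> U x ->
  (forall y, U y -> P y) -> \forall y \near x, P y.
Proof. by move=> oU Ux h; apply: filterS h _; exact: open_nbhs_nbhs. Qed.

Lemma is_Ck_sub k U V f : V `<=` U -> is_Ck k U f -> is_Ck k V f.
Proof.
move=> VU; elim: k f => [|k ih] f /=; first by move=> h x /VU; exact: h.
by move=> [h1 h2]; split=> [x /VU|i]; [exact: h1|exact: ih].
Qed.

Lemma is_Ck_eq k U f g : open U -> (forall y, U y -> f y = g y) ->
  is_Ck k U f -> is_Ck k U g.
Proof.
move=> oU; elim: k f g => [|k ih] f g e /=.
  move=> h x Ux; have := h x Ux; rewrite /prop_for /continuous_at -(e _ Ux).
  by apply: cvg_trans; exact: (near_eq_cvg (near_open oU Ux e)).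
move=> [h1 h2]; split=> [x Ux|i].
  by apply: (differentiable_near (f := f)); [exact: (near_open oU Ux)|exact: h1].
apply: ih (h2 i) => y Uy; rewrite !partialE; apply: near_eq_derive.
by apply: (near_open oU Uy) => z Uz; exact: e.
Qed.

Lemma is_Ck_local k U f :
  (forall x, U x -> exists V, [/\ open V, V x & is_Ck k V f]) -> is_Ck k U f.
Proof.
elim: k f => [|k ih] f h /=.
  by move=> x /h [V [_ Vx hV]]; exact: hV.
split=> [x /h [V [_ Vx [d _]]]|i]; first exact: d.
by apply: ih => x /h [V [oV Vx [_ d]]]; exists V; split=> //; exact: d.
Qed.

Definition twice_differentiable U f :=
  (forall x, U x -> differentiable f x) /\
  (forall i x, U x -> differentiable (partial i f) x).

Lemma is_Ck2_twice U f : is_Ck 2 U f -> twice_differentiable U f.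
Proof. by move=> [h1 h2]; split=> // i; have [] := h2 i. Qed.

Lemma twice_differentiable_hasgrad U f (df : 'I_n -> 'rV[R]_n -> R)
    (d2f : 'I_n -> 'I_n -> 'rV[R]_n -> R) : open U ->
  (forall x, U x -> hasgrad f x (df^~ x)) ->
  (forall i x, U x -> hasgrad (df i) x (d2f i ^~ x)) ->
  twice_differentiable U f /\
  forall x i j, U x -> partial j (partial i f) x = d2f i j x.
Proof.
move=> oU h1 h2.
have h3 i x : U x -> hasgrad (partial i f) x (d2f i ^~ x).
  move=> Ux; apply: (hasgrad_near _ (h2 i x Ux)).
  by apply: (near_open oU Ux) => y Uy; rewrite (h1 y Uy).2.
split=> [|x i j Ux]; last exact: (h3 i x Ux).2.
by split=> [x /h1 []|i x /(h3 i) []].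
Qed.

Lemma twice_differentiable_lin U (a b : R) f g : open U ->
  twice_differentiable U f -> twice_differentiable U g ->
  twice_differentiable U (fun y => a * f y + b * g y) /\
  forall x, U x -> laplacian (fun y => a * f y + b * g y) x
                   = a * laplacian f x + b * laplacian g x.
Proof.
move=> oU [f1 f2] [g1 g2].
have [h1 h2] := @twice_differentiable_hasgrad U (fun y => a * f y + b * g y)
  (fun i y => a * partial i f y + b * partial i g y)
  (fun i j y => a * partial j (partial i f) y + b * partial j (partial i g) y) oU
  (fun x Ux => hasgradD (hasgradZ a (hasgrad_partial (f1 x Ux)))
                        (hasgradZ b (hasgrad_partial (g1 x Ux))))
  (fun i x Ux => hasgradD (hasgradZ a (hasgrad_partial (f2 i x Ux)))
                          (hasgradZ b (hasgrad_partial (g2 i x Ux)))).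
split=> // x Ux; rewrite /laplacian !mulr_sumr -big_split /=.
by apply: eq_bigr => i _; exact: h2.
Qed.

End Smoothness.

Section SquaredNorm.
Variables (R : realType) (n : nat).
Implicit Types (x y p : 'rV[R]_n).

Definition sqnorm x : R := \sum_i x ord0 i ^+ 2.

Lemma sqnorm_ge0 x : 0 <= sqnorm x.
Proof. by apply: sumr_ge0 => i _; exact: sqr_ge0. Qed.

Lemma enorm_sqr x : enorm x ^+ 2 = sqnorm x.
Proof. by rewrite sqr_sqrtr // sqnorm_ge0. Qed.

Lemma enorm_ge0 x : 0 <= enorm x. Proof. exact: sqrtr_ge0. Qed.

Lemma sqnorm_eq0 x : (sqnorm x == 0) = (x == 0).
Proof.
rewrite psumr_eq0 => [|i _]; last exact: sqr_ge0.
apply/allP/eqP => [h|-> i _]; last by rewrite mxE expr0n eqxx.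
apply/rowP => i; rewrite mxE; apply/eqP; rewrite -sqrf_eq0.
exact: h (mem_index_enum i).
Qed.

Lemma sqnormZ (a : R) x : sqnorm (a *: x) = a ^+ 2 * sqnorm x.
Proof.
by rewrite /sqnorm mulr_sumr; apply: eq_bigr => i _; rewrite mxE exprMn.
Qed.

Lemma sqnormN x : sqnorm (- x) = sqnorm x.
Proof. by apply: eq_bigr => i _; rewrite mxE sqrrN. Qed.

Lemma sqnormD_le x y : sqnorm (x + y) <= 2 * sqnorm x + 2 * sqnorm y.
Proof.
rewrite /sqnorm !mulr_sumr -big_split /=; apply: ler_sum => i _.
rewrite !mxE; move: (x ord0 i) (y ord0 i) => s t.
by rewrite -subr_ge0 (_ : _ - _ = (s - t) ^+ 2) ?sqr_ge0 //; ring.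
Qed.

Lemma sqr_coord_le x i : x ord0 i ^+ 2 <= sqnorm x.
Proof.
by rewrite /sqnorm (bigD1 i) //= lerDl sumr_ge0 // => j _; exact: sqr_ge0.
Qed.

Lemma norm_le_enorm x : `|x| <= enorm x.
Proof.
rewrite [leLHS]mx_normrE; apply: bigmax_le; first exact: enorm_ge0.
move=> [k j] _ /=; rewrite ord1 -(@ler_pXn2r _ 2) ?nnegrE ?enorm_ge0 //.
by rewrite enorm_sqr real_normK ?num_real // sqr_coord_le.
Qed.

Lemma sqnorm_le_norm x : sqnorm x <= n%:R * `|x| ^+ 2.
Proof.
have -> : n%:R * `|x| ^+ 2 = \sum_(i < n) `|x| ^+ 2.
  by rewrite sumr_const card_ord mulr_natl.
apply: ler_sum => i _; rewrite -real_normK ?num_real //.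
rewrite ler_pXn2r ?nnegrE //.
by rewrite [leRHS]mx_normrE; apply: (le_bigmax _ (fun k => `|x k.1 k.2|) (ord0, i)).
Qed.

Lemma hasgrad_coord_sub p x (i : 'I_n) :
  hasgrad (fun y => (y - p) ord0 i) x (fun j => (i == j)%:R).
Proof.
have -> : (fun y : 'rV[R]_n => (y - p) ord0 i) = (fun y => y ord0 i - p ord0 i).
  by apply/funext => y; rewrite !mxE.
apply: (hasgrad_eq (hasgradB (hasgrad_coord x i) (hasgrad_cst (p ord0 i) x))).
by move=> j; rewrite subr0.
Qed.

Lemma hasgrad_sqnorm p x :
  hasgrad (fun y => sqnorm (y - p)) x (fun i => 2 * (x - p) ord0 i).
Proof.
apply: (hasgrad_eq (hasgrad_sum (index_enum _) predT
  (fun k => hasgradX 2 (hasgrad_coord_sub p x k)))) => i.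
rewrite (bigD1 i) //= eqxx mulr1 big1 ?addr0 // => k /negPf ki.
by rewrite ki mulr0.
Qed.

Lemma sqnorm_continuous : continuous sqnorm.
Proof.
move=> x; apply: differentiable_continuous.
have -> : sqnorm = (fun y => sqnorm (y - 0)).
  by apply/funext => y; rewrite subr0.
by have [] := hasgrad_sqnorm 0 x.
Qed.

Lemma enorm_le x (M : R) : 0 <= M -> (enorm x <= M) = (sqnorm x <= M ^+ 2).
Proof.
by move=> M0; rewrite -enorm_sqr ler_pXn2r // nnegrE // enorm_ge0.
Qed.

Lemma compact_exterior (A : set 'rV[R]_n) (M : R) : closed A -> 0 <= M ->
  compact (A `&` [set x | sqnorm x <= M ^+ 2]).
Proof.
move=> cA M0; apply: bounded_closed_compact; last first.
  apply: closedI => //.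
  rewrite (_ : [set _ | _] = sqnorm @^-1` [set t | t <= M ^+ 2]) //.
  by apply: preimage_closed; [move=> x _; exact: sqnorm_continuous|exact: closed_le].
exists M; split; first exact: num_real.
move=> N MN x [_ /=]; rewrite -enorm_le // => h.
exact: (le_trans (norm_le_enorm x) (le_trans h (ltW MN))).
Qed.

End SquaredNorm.

Section Exterior.
Variables (R : realType) (n : nat) (Omega : set 'rV[R]_n).
Hypothesis oOmega : open Omega.
Implicit Types (x y z : 'rV[R]_n).

Lemma exterior_open : open (~` closure Omega).
Proof. exact/closed_openC/closed_closure. Qed.

Lemma exterior_notin x : (~` closure Omega) x -> ~ Omega x.
Proof. by move=> Ex Ox; apply: Ex; exact: subset_closure. Qed.

Lemma complement_cases x : ~ Omega x -> boundary Omega x \/ (~` closure Omega) x.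
Proof.
move=> nx; have [cx|cx] := pselect (closure Omega x); last by right.
by left; split=> //; rewrite (interior_id _).1.
Qed.

Lemma boundary_notin x : boundary Omega x -> ~ Omega x.
Proof. by move=> [_]; rewrite (interior_id _).1. Qed.

Lemma smooth_on_exterior (u : 'rV[R]_n -> R) k :
  smooth_on (~` Omega) u -> is_Ck k (~` closure Omega) u.
Proof.
move=> su; apply: is_Ck_local => x Ex.
have [U [g [oU Ux sg e]]] := su x (exterior_notin Ex).
exists (U `&` ~` closure Omega); split=> //.
  by apply: openI => //; exact: exterior_open.
apply: (is_Ck_eq (f := g)).
- by apply: openI => //; exact: exterior_open.
- by move=> y [Uy Ey]; rewrite e //; exact: exterior_notin.
- by apply: is_Ck_sub (sg k) => y [].
Qed.

Lemma smooth_on_continuous (S : set 'rV[R]_n) (u : 'rV[R]_n -> R) :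
  smooth_on S u -> {within S, continuous u}.
Proof.
move=> su; apply/subspace_continuousP => x Sx.
have [U [g [oU Ux sg e]]] := su x Sx.
suff : u @ within S (nbhs x) --> g x by rewrite -(e x Ux Sx).
have cg : g @ x --> g x by exact: (sg 0).
move=> A /cg hA.
have nU : nbhs x U by exact: open_nbhs_nbhs.
suff : nbhs x [set y | S y -> A (u y)] by [].
have {}hA : nbhs x (g @^-1` A) by exact: hA.
by move: hA nU; apply: filterS2 => y /= Ay Uy Sy; rewrite (e y Uy Sy).
Qed.

Lemma max_principle (h : 'rV[R]_n -> R) (m : R) : (0 < n)%N ->
  {within ~` Omega, continuous h} -> twice_differentiable (~` closure Omega) h ->
  (forall x, (~` closure Omega) x -> laplacian h x = 0) ->
  (forall x, boundary Omega x -> h x <= m) ->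
  (forall e, 0 < e -> exists M : R, forall x, ~ Omega x -> M < enorm x -> h x <= m + e) ->
  forall x, ~ Omega x -> h x <= m.
Proof.
move=> n0 ch [dh d2h] lh bh ih x0 Ox0; rewrite leNgt; apply/negP => hx0.
pose e := (h x0 - m) / 3.
have e0 : 0 < e by rewrite divr_gt0 // subr_gt0.
have he : h x0 = m + 3 * e by rewrite /e mulrC divfK // addrC subrK.
have [M0 hM0] := ih e e0.
pose M := Num.max M0 0.
have M_ge0 : 0 <= M by rewrite le_max lexx orbT.
have hM x : ~ Omega x -> M < enorm x -> h x <= m + e.
  by move=> Ox; rewrite gt_max => /andP[? _]; exact: hM0.
pose eps := e / (M ^+ 2 + 1).
have M2 : 0 < M ^+ 2 + 1 by rewrite ltr_wpDl // sqr_ge0.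
have eps0 : 0 < eps by rewrite divr_gt0.
have epsM : eps * (M ^+ 2 + 1) = e by rewrite divfK // gt_eqF.
pose f y := h y + eps * sqnorm (y - 0).
pose K := ~` Omega `&` [set y | sqnorm y <= M ^+ 2].
have Kx0 : K x0.
  split=> //=; rewrite -enorm_le // leNgt; apply/negP => /(hM _ Ox0).
  by rewrite he; lra.
have cf : {within K, continuous f}.
  apply/subspace_continuousP => y Ky; apply: cvgD.
    have /subspace_continuousP/(_ y Ky.1) := ch.
    by apply: cvg_trans; apply: cvg_app; apply: within_subset => z [].
  apply: cvg_within_filter.
  exact: (differentiable_continuous (hasgradZ eps (hasgrad_sqnorm 0 y)).1).
have [|z zK zmax] := EVT_max_rV (ex_intro _ x0 Kx0) _ cf.
  by apply: compact_exterior => //; exact: open_closedC.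
move: zK; rewrite inE => -[Oz /= zM].
have fz : m + 3 * e <= f z.
  apply: (@le_trans _ _ (f x0)); last by apply: zmax; rewrite inE.
  by rewrite /f he lerDl mulr_ge0 ?sqnorm_ge0 // ltW.
have epsz : eps * sqnorm z <= e - eps.
  by rewrite -epsM mulrDr mulr1 addrK ler_wpM2l // ltW.
have hz : m + 2 * e < h z.
  by move: fz; rewrite /f subr0; lra.
have [bz|Ez] := complement_cases Oz.
  by have := bh z bz; lra.
have oE := exterior_open.
have hg y : (~` closure Omega) y ->
    hasgrad f y (fun i => partial i h y + eps * (2 * (y - 0) ord0 i)).
  move=> Ey; apply: hasgradD; first exact/hasgrad_partial/dh.
  exact/hasgradZ/hasgrad_sqnorm.
have hmax : \forall y \near z, f y <= f z.
  have near1 : \forall y \near z, sqnorm y < M ^+ 2 + 1.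
    apply: (cvgr_lt _ (@sqnorm_continuous R n z)).
    by rewrite (le_lt_trans zM) // ltrDl.
  near=> y.
  have Ey : (~` closure Omega) y by near: y; exact: open_nbhs_nbhs.
  have Oy := exterior_notin Ey.
  have [yM|yM] := leP (sqnorm y) (M ^+ 2).
    by apply: zmax; rewrite inE.
  have hy : h y <= m + e.
    by apply: hM => //; rewrite ltNge enorm_le // -ltNge.
  apply: (le_trans _ fz).
  have : eps * sqnorm y <= e.
    rewrite -epsM ler_wpM2l //; first exact: ltW.
    by apply: ltW; near: y.
  rewrite /f subr0; lra.
have hg2 i : hasgrad (partial i f) z (fun j => partial j (partial i h) z + eps * (2 * (i == j)%:R)).
  apply: (hasgrad_near (f := fun y => partial i h y + eps * (2 * (y - 0) ord0 i))).
    by apply: (near_open oE Ez) => y Ey; rewrite (hg y Ey).2.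
  apply: hasgradD; first exact/hasgrad_partial/d2h.
  exact/hasgradZ/hasgradZ/hasgrad_coord_sub.
have : \sum_(i < n) partial i (partial i f) z <= 0.
  apply: sumr_le0 => i _; apply: (local_max_partial2 oE Ez) => //.
    by move=> y Ey; have [] := hg y Ey.
  by have [] := hg2 i.
have -> : \sum_(i < n) partial i (partial i f) z =
    \sum_(i < n) (partial i (partial i h) z + eps * 2).
  by apply: eq_bigr => i _; rewrite (hg2 i).2 eqxx mulr1.
rewrite big_split /= -/(laplacian h z) lh // add0r sumr_const card_ord.
by rewrite leNgt pmulrn_lgt0 // mulr_gt0.
Unshelve. all: by end_near. Qed.

End Exterior.

Section PotentialBounds.
Variables (R : realType) (n : nat) (Omega : set 'rV[R]_n) (u : 'rV[R]_n -> R).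
Hypothesis n0 : (0 < n)%N.
Hypothesis oOmega : open Omega.
Hypothesis hu : electrostatic_potential Omega u.
Implicit Types (x y z : 'rV[R]_n).
Let E := ~` closure Omega.

Lemma potential_Ck k : is_Ck k E u.
Proof. by have [su _ _ _] := hu; exact: smooth_on_exterior. Qed.

Lemma potential_twice : twice_differentiable E u.
Proof. exact/is_Ck2_twice/potential_Ck. Qed.

Lemma potential_compare (v : 'rV[R]_n -> R) (a b m : R) :
  {within ~` Omega, continuous v} -> twice_differentiable E v ->
  (forall x, E x -> laplacian v x = 0) ->
  (forall x, boundary Omega x -> a + b * v x <= m) ->
  (forall e, 0 < e -> exists M : R, forall x, ~ Omega x -> M < enorm x -> b * v x <= m + e) ->
  forall x, ~ Omega x -> a * u x + b * v x <= m.
Proof.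
move=> cv dv lv bv iv; have [su lu bu iu] := hu.
have cu := smooth_on_continuous su.
have [dh lh] := twice_differentiable_lin a b (@exterior_open R n Omega) potential_twice dv.
apply: (max_principle oOmega n0 _ dh).
- have scal (k : R) (f : 'rV[R]_n -> R) : {within ~` Omega, continuous f} ->
      {within ~` Omega, continuous (fun x => k * f x)}.
    by move=> cf x; apply: cvgM; [exact: cvg_cst|exact: cf].
  by move=> x; apply: cvgD; exact: scal.
- by move=> x Ex; rewrite lh // lu // lv // !mulr0 addr0.
- by move=> x bx; rewrite bu // mulr1 bv.
move=> e e0; have e2 : 0 < e / 2 by rewrite divr_gt0.
have [M1 h1] := iv _ e2.
have a0 : 0 < `|a| + 1 by rewrite ltr_wpDl.
have [M2 h2] := iu (e / 2 / (`|a| + 1)) (divr_gt0 e2 a0).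
exists (Num.max M1 M2) => x Ox; rewrite gt_max => /andP[x1 x2].
have := h1 x Ox x1; have := h2 x Ox x2.
rewrite ltr_pdivlMr // => k2 k1.
have : a * u x <= `|u x| * (`|a| + 1).
  apply: (le_trans (ler_norm _)); rewrite normrM mulrC ler_wpM2l //.
  by rewrite lerDl.
move: k1 k2; move: (_ * v x) (_ * u x) (_ * (_ + _)) => p q r; lra.
Qed.

Let compare0 (a m : R) : a <= m -> 0 <= m -> forall x, ~ Omega x -> a * u x <= m.
Proof.
move=> am m0 x Ox.
have dz i : partial i (fun=> 0 : R) = (fun=> 0) :> ('rV[R]_n -> R).
  by apply/funext => y; rewrite (hasgrad_cst 0 y).2.
rewrite -[leLHS]addr0 -[X in _ + X](mulr0 (0:R)).
apply: (@potential_compare (fun=> 0)) => //.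
- by move=> y; exact: cvg_cst.
- split=> [y _|i y _]; first exact: differentiable_cst.
  by rewrite dz; exact: differentiable_cst.
- by move=> y _; rewrite /laplacian big1 // => i _; rewrite dz dz.
- by move=> y _; rewrite mulr0 addr0.
- by move=> e e0; exists 0 => y _ _; rewrite mulr0 addr_ge0 // ltW.
Qed.

Lemma potential_le1 x : ~ Omega x -> u x <= 1.
Proof. by move=> Ox; rewrite -[u x]mul1r; apply: compare0. Qed.

Lemma potential_ge0 x : ~ Omega x -> 0 <= u x.
Proof.
by move=> Ox; rewrite -oppr_le0 -mulN1r; apply: compare0 => //; rewrite oppr_le0.
Qed.

Lemma local_extremum_crit (a : R) x : a != 0 -> E x ->
  (forall y, E y -> a * u y <= a * u x) -> Crit u x.
Proof.
move=> a0 Ex h; apply/rowP => i; rewrite !mxE.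
have oE := @exterior_open R n Omega.
have [du _] := potential_twice.
have dau y : E y -> hasgrad (fun z => a * u z) y (fun i => a * partial i u y).
  by move=> Ey; exact/hasgradZ/hasgrad_partial/du.
have := local_max_partial i oE Ex (fun y Ey => (dau y Ey).1) (near_open oE Ex h).
by rewrite (dau x Ex).2 => /eqP; rewrite mulf_eq0 (negPf a0) => /eqP.
Qed.

(* An interior extremum would be a critical point, so the weak maximum
   principle already gives strict bounds off Crit u. *)
Lemma potential_strict x : E x -> ~ Crit u x -> 0 < u x < 1.
Proof.
move=> Ex nx; have Ox := exterior_notin Ex.
apply/andP; split; rewrite lt_neqAle ?potential_ge0 ?potential_le1 // andbT.
  apply/eqP => u0; apply: nx; apply: (@local_extremum_crit (- 1)) => //.
  move=> y Ey; rewrite -u0 mulr0 mulN1r oppr_le0 potential_ge0 //.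
  exact: exterior_notin.
apply/eqP => u1; apply: nx; apply: (@local_extremum_crit 1) => //.
by move=> y Ey; rewrite u1 !mul1r potential_le1 //; exact: exterior_notin.
Qed.

End PotentialBounds.

Section RefinedKato.
Variables (R : realFieldType) (n : nat) (A : 'I_n -> 'I_n -> R) (v : 'I_n -> R).
Hypothesis n2 : (2 <= n)%N.
Hypothesis Asym : forall i j, A i j = A j i.
Hypothesis Atr : \sum_i A i i = 0.

Let N : R := n%:R.
Let b i := \sum_j A i j * v j.
Let w := \sum_i v i ^+ 2.
Let h2 := \sum_i \sum_j A i j ^+ 2.
Let b2 := \sum_i b i ^+ 2.
Let bv := \sum_i b i * v i.
Hypothesis w0 : 0 < w.

Lemma sum_delta (f : 'I_n -> R) i : \sum_j (i == j)%:R * f j = f i.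
Proof.
rewrite (bigD1 i) //= eqxx mul1r big1 ?addr0 // => j /negPf ji.
by rewrite eq_sym ji mul0r.
Qed.

Let N1 : 0 < N - 1. Proof. by rewrite subr_gt0 ltr1n. Qed.
Let N2 : 0 <= N - 2. Proof. by rewrite subr_ge0 ler_nat. Qed.

(* w^2 (P A P + <A e, e> P / (n - 1)), where e = v / |v| and P is the
   orthogonal projection onto the complement of e. *)
Definition kato_rest i j :=
  w ^+ 2 * A i j - w * (v i * b j + b i * v j) + (bv - bv / (N - 1)) * (v i * v j)
  + bv * w / (N - 1) * (i == j)%:R.

Definition kato_deficit := h2 - N / (N - 1) * (b2 / w).

Let sum_Avb : \sum_i v i * (\sum_j A i j * b j) = b2.
Proof.
under eq_bigr do rewrite mulr_sumr.
rewrite exchange_big /=; apply: eq_bigr => j _.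
rewrite expr2 {2}/b mulr_suml; apply: eq_bigr => i _.
by rewrite (Asym i j); ring.
Qed.

Let row_sum i : \sum_j kato_rest i j ^+ 2 =
  w ^+ 4 * (\sum_j A i j ^+ 2) - 2 * w ^+ 3 * (v i * \sum_j A i j * b j)
  + 2 * w ^+ 2 * (bv * w / (N - 1)) * A i i
  + (w ^+ 2 * b2 + (bv - bv / (N - 1)) ^+ 2 * w
     - 2 * w * (bv - bv / (N - 1)) * bv
     + 2 * (bv - bv / (N - 1)) * (bv * w / (N - 1))) * v i ^+ 2
  - w ^+ 3 * b i ^+ 2
  + (2 * w ^+ 2 * bv - 4 * w * (bv * w / (N - 1))) * (b i * v i)
  + (bv * w / (N - 1)) ^+ 2.
Proof.
pose k := bv - bv / (N - 1); pose m := bv * w / (N - 1).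
rewrite (eq_bigr (fun j => w ^+ 4 * A i j ^+ 2 + w ^+ 2 * v i ^+ 2 * b j ^+ 2
  + (w ^+ 2 * b i ^+ 2 + k ^+ 2 * v i ^+ 2 - 2 * w * k * b i * v i) * v j ^+ 2
  + (- 2 * w ^+ 3 * v i) * (A i j * b j)
  + (2 * k * w ^+ 2 * v i - 2 * w ^+ 3 * b i) * (A i j * v j)
  + (2 * w ^+ 2 * v i * b i - 2 * w * k * v i ^+ 2) * (b j * v j)
  + (i == j)%:R * (m ^+ 2 + 2 * m * w ^+ 2 * A i j - 2 * w * m * (v i * b j + b i * v j)
     + 2 * m * k * v i * v j))); last first.
  move=> j _; rewrite /kato_rest -/k -/m; case: (i == j) => /=; ring.
rewrite !big_split /= sum_delta -!mulr_sumr -/w -/b2 -/bv -/(b i) -/k -/m; ring.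
Qed.

Lemma kato_deficitE : w ^+ 4 * kato_deficit =
  \sum_i \sum_j kato_rest i j ^+ 2
  + (N - 2) / (N - 1) * w * \sum_i (w * b i - bv * v i) ^+ 2.
Proof.
have -> : \sum_i (w * b i - bv * v i) ^+ 2 = w ^+ 2 * b2 - bv ^+ 2 * w.
  rewrite (eq_bigr (fun i => w ^+ 2 * b i ^+ 2 - 2 * w * bv * (b i * v i) + bv ^+ 2 * v i ^+ 2)).
    rewrite !big_split /= sumrN -!mulr_sumr -/w -/b2 -/bv; ring.
  by move=> i _; ring.
rewrite (eq_bigr _ (fun i _ => row_sum i)) !big_split /= !sumrN.
rewrite -!mulr_sumr sum_Avb Atr sumr_const card_ord -/w -/b2 -/bv -/h2 -mulr_natl -/N.
rewrite /kato_deficit; field.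
by rewrite !gt_eqF.
Qed.

Lemma kato_deficit_ge0 : 0 <= kato_deficit.
Proof.
rewrite -(pmulr_rge0 _ (exprn_gt0 4 w0)) kato_deficitE addr_ge0 //.
  by apply: sumr_ge0 => i _; apply: sumr_ge0 => j _; exact: sqr_ge0.
rewrite mulr_ge0 ?mulr_ge0 ?invr_ge0 ?(ltW w0) ?(ltW N1) //.
by apply: sumr_ge0 => i _; exact: sqr_ge0.
Qed.

Lemma kato_deficit_eq0 : (3 <= n)%N -> kato_deficit = 0 -> forall i j,
  A i j = - (bv / ((N - 1) * w)) * ((i == j)%:R - N * (v i * v j) / w).
Proof.
move=> n3 D0 i j; have := kato_deficitE; rewrite D0 mulr0 => /esym/eqP.
have N2' : 0 < N - 2 by rewrite subr_gt0 ltr_nat.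
rewrite paddr_eq0; first last.
- rewrite mulr_ge0 ?mulr_ge0 ?invr_ge0 ?(ltW w0) ?(ltW N1) //.
  by apply: sumr_ge0 => k _; exact: sqr_ge0.
- by apply: sumr_ge0 => k _; apply: sumr_ge0 => l _; exact: sqr_ge0.
move=> /andP[Z0 Y0].
have Z0ij : kato_rest i j = 0.
  apply/eqP; rewrite -sqrf_eq0; move: Z0.
  rewrite psumr_eq0 => [|k _]; last by apply: sumr_ge0 => l _; exact: sqr_ge0.
  move=> /allP/(_ i (mem_index_enum i)) /=.
  rewrite psumr_eq0 => [|l _]; last exact: sqr_ge0.
  by move=> /allP/(_ j (mem_index_enum j)).
have Y0i k : w * b k = bv * v k.
  apply/eqP; rewrite -subr_eq0 -sqrf_eq0; move: Y0.
  rewrite mulf_eq0 (gt_eqF (mulr_gt0 (divr_gt0 N2' N1) w0)) /=.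
  rewrite psumr_eq0 => [|l _]; last exact: sqr_ge0.
  by move=> /allP/(_ k (mem_index_enum k)).
have wn : w != 0 by rewrite gt_eqF.
have bk k : b k = bv * v k / w by rewrite -Y0i mulrC mulKf.
apply: (mulfI (expf_neq0 2 wn)).
move/eqP: Z0ij; rewrite /kato_rest !bk.
set d := (i == j)%:R; move=> Z.
rewrite -[LHS]subr0 -(eqP Z); field.
by rewrite !gt_eqF.
Qed.

Lemma kato_equality (lam : R) :
  (forall i j, A i j = lam * ((i == j)%:R - N * (v i * v j) / w)) ->
  kato_deficit = 0.
Proof.
move=> hA.
have wn : w != 0 by rewrite gt_eqF.
have hb i : b i = lam * (1 - N) * v i.
  rewrite /b (eq_bigr (fun j => (i == j)%:R * (lam * v j) - lam * N * v i / w * v j ^+ 2)).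
    by rewrite big_split /= sumrN sum_delta -mulr_sumr -/w; field.
  by move=> j _; rewrite hA; field.
have hb2 : b2 = (lam * (1 - N)) ^+ 2 * w.
  by rewrite /b2 /w mulr_sumr; apply: eq_bigr => i _; rewrite hb exprMn.
have hh2 : h2 = lam ^+ 2 * (N ^+ 2 - N).
  rewrite /h2 (eq_bigr (fun i => lam ^+ 2
      + (lam ^+ 2 * N ^+ 2 / w - 2 * lam ^+ 2 * N / w) * v i ^+ 2)).
    rewrite big_split /= sumr_const card_ord -mulr_sumr -/w -[lam ^+ 2 *+ n]mulr_natl -/N; field.
    exact: wn.
  move=> i _.
  rewrite (eq_bigr (fun j => (i == j)%:R * (lam ^+ 2 * (1 - 2 * N * (v i * v j) / w))
     + lam ^+ 2 * N ^+ 2 * v i ^+ 2 / w ^+ 2 * v j ^+ 2)).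
    by rewrite big_split /= sum_delta -mulr_sumr -/w; field.
  by move=> j _; rewrite hA; case: (i == j) => /=; field.
by rewrite /kato_deficit hb2 hh2; field; rewrite wn gt_eqF.
Qed.

End RefinedKato.

Lemma powR_addr1 (R : realType) (t a : R) : 0 < t -> t `^ (a + 1) = t * t `^ a.
Proof.
move=> t0; rewrite powRD ?powRr1 ?(ltW t0) // 1?mulrC //.
by rewrite (gt_eqF t0) implybT.
Qed.

Section FluxDivergence.
Variables (R : realType) (n : nat) (U : set 'rV[R]_n).
Variables (u : 'rV[R]_n -> R) (u1 : 'I_n -> 'rV[R]_n -> R).
Variables (u2 : 'I_n -> 'I_n -> 'rV[R]_n -> R).
Variables (u3 : 'I_n -> 'I_n -> 'I_n -> 'rV[R]_n -> R).
Hypothesis n3 : (3 <= n)%N.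
Hypothesis oU : open U.
Hypothesis gu : forall x, U x -> hasgrad u x (u1^~ x).
Hypothesis gu1 : forall i x, U x -> hasgrad (u1 i) x (u2 i ^~ x).
Hypothesis gu2 : forall i j x, U x -> hasgrad (u2 i j) x (u3 i j ^~ x).
Hypothesis u2C : forall i j x, U x -> u2 i j x = u2 j i x.
Hypothesis u2tr : forall x, U x -> \sum_i u2 i i x = 0.
Hypothesis u3tr : forall i x, U x -> \sum_k u3 k i k x = 0.

Let w x := \sum_i u1 i x ^+ 2.
Let B i x := \sum_j u2 i j x * u1 j x.
Let h2 x := \sum_i \sum_j u2 i j x ^+ 2.
Let N : R := n%:R.

Lemma grad_w x : U x -> hasgrad w x (fun i => 2 * B i x).
Proof.
move=> Ux; apply: (hasgrad_eq (hasgrad_sum (index_enum _) predT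
  (fun k => hasgradX 2 (gu1 k Ux)))) => i.
rewrite /B mulr_sumr; apply: eq_bigr => j _ /=.
by rewrite (u2C i j Ux) expr1; ring.
Qed.

Lemma grad_B i x : U x -> hasgrad (B i) x
  (fun k => \sum_j (u3 i j k x * u1 j x + u2 i j x * u2 j k x)).
Proof.
move=> Ux; exact: (hasgrad_sum (index_enum _) predT
  (fun j => hasgradM (gu2 i j Ux) (gu1 j Ux))).
Qed.

Lemma div_B x : U x ->
  \sum_i \sum_j (u3 i j i x * u1 j x + u2 i j x * u2 j i x) = h2 x.
Proof.
move=> Ux; rewrite exchange_big /= /h2 [RHS]exchange_big /=.
apply: eq_bigr => j _; rewrite big_split /= -mulr_suml u3tr // mul0r add0r.
by apply: eq_bigr => i _; rewrite (u2C j i Ux) expr2.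
Qed.

Variables (beta c d : R).
Hypothesis w0 : forall x, U x -> 0 < w x.
Hypothesis u0 : forall x, U x -> 0 < u x.
Let K := (N - 1) / (N - 2) * beta.
Let z x := u x `^ (- K).
Let q x := w x `^ (beta / 2 - 2).

Let N2 : 0 < N - 2. Proof. by rewrite subr_gt0 ltr_nat. Qed.
Let N1 : 0 < N - 1. Proof. by rewrite subr_gt0 ltr1n ltnW. Qed.

Let grad_pow (f : 'rV[R]_n -> R) x df (a : R) : 0 < f x -> hasgrad f x df ->
  hasgrad (fun y => f y `^ a) x (fun i => a * f x `^ a / f x * df i).
Proof.
move=> f0 h; apply: (hasgrad_eq (hasgrad_powR a f0 h)) => i.
congr (_ * _); rewrite -mulrA; congr (_ * _).
by rewrite -{2}(subrK 1 a) powR_addr1 // mulrC mulKf // gt_eqF.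
Qed.

(* The components of the flux, with all real powers reduced to those of [z]
   and [q]. *)
Let Phi i x := z x * q x * (beta * ((c * u x + d) * u x) * w x * B i x
   + (d - K * (c * u x + d)) * w x ^+ 2 * u1 i x).

Lemma enorm_grad_powR (a : R) y : (forall i, partial i u y = u1 i y) ->
  enorm (grad u y) `^ a = w y `^ (a / 2).
Proof.
move=> e.
have -> : enorm (grad u y) = w y `^ 2^-1.
  rewrite powR12_sqrt; last by apply: sumr_ge0 => i _; exact: sqr_ge0.
  by congr Num.sqrt; apply: eq_bigr => i _; rewrite mxE e.
by rewrite -powRrM mulrC.
Qed.

Lemma Ffun_z x : U x -> Ffun n beta c d (u x) = (c * u x + d) * u x * z x.
Proof.
move=> Ux; rewrite /Ffun -/N -/K -mulrA; congr (_ * _).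
by rewrite addrC powR_addr1 ?u0.
Qed.

Lemma flux_coord i x : U x -> flux beta c d u x ord0 i = Phi i x.
Proof.
move=> Ux; rewrite /flux !mxE.
have pu y : U y -> forall i, partial i u y = u1 i y by move=> Uy j; rewrite (gu Uy).2.
rewrite (enorm_grad_powR _ (pu x Ux)) pu //.
have -> : partial i (fun y => enorm (grad u y) `^ beta) x = beta * (w x * q x) * B i x.
  have gw := grad_pow (beta / 2) (w0 Ux) (grad_w Ux).
  have [_ ->] : hasgrad (fun y => enorm (grad u y) `^ beta) x
      (fun i => beta / 2 * w x `^ (beta / 2) / w x * (2 * B i x)).
    apply: (hasgrad_near _ gw); apply: (near_open oU Ux) => y Uy.
    by rewrite (enorm_grad_powR _ (pu y Uy)).
  rewrite /q -{2}(subrK 2 (beta / 2)) (_ : 2 = 1 + 1) // addrA.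
  rewrite !powR_addr1 ?w0 //; move: (_ `^ _) => t.
  by field; rewrite gt_eqF ?w0.
rewrite Ffun_z // /Gfun Ffun_z // -/N -/K.
have -> : w x `^ (beta / 2) = w x ^+ 2 * q x.
  rewrite /q -{1}(subrK 2 (beta / 2)) (_ : 2 = 1 + 1) // addrA.
  by rewrite !powR_addr1 ?w0 // mulrA -expr2.
rewrite /Phi -/(z x) /K; move: (z x) (q x) => t s; field.
by rewrite !gt_eqF ?u0.
Qed.

Let b2 x := \sum_i B i x ^+ 2.
Let bu x := \sum_i B i x * u1 i x.

Lemma defect_sqr x : U x ->
  enorm (defect u x) ^+ 2 = 4 * b2 x
   - 8 * ((N - 1) / (N - 2)) * (w x / u x) * bu x
   + 4 * ((N - 1) / (N - 2)) ^+ 2 * (w x ^+ 3 / u x ^+ 2).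
Proof.
move=> Ux; rewrite enorm_sqr /sqnorm.
have pu y : U y -> forall i, partial i u y = u1 i y by move=> Uy j; rewrite (gu Uy).2.
have ew y : U y -> enorm (grad u y) ^+ 2 = w y.
  by move=> Uy; rewrite enorm_sqr; apply: eq_bigr => i _; rewrite mxE pu.
have [_ pw] : hasgrad (fun y => enorm (grad u y) ^+ 2) x (fun i => 2 * B i x).
  apply: (hasgrad_near _ (grad_w Ux)).
  by apply: (near_open oU Ux) => y Uy; rewrite ew.
rewrite (eq_bigr (fun i => 4 * B i x ^+ 2
   - 8 * ((N - 1) / (N - 2)) * (w x / u x) * (B i x * u1 i x)
   + 4 * ((N - 1) / (N - 2)) ^+ 2 * (w x ^+ 2 / u x ^+ 2) * u1 i x ^+ 2)); last first.
  move=> i _; rewrite /defect !mxE pw ew // pu // -/N.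
  by field; rewrite !gt_eqF ?u0.
rewrite !big_split /= sumrN -!mulr_sumr -/(w x) -/(b2 x) -/(bu x); field.
by rewrite !gt_eqF ?u0.
Qed.

Lemma divergence_flux x : U x ->
  divergence (flux beta c d u) x =
  Ffun n beta c d (u x) * enorm (grad u x) `^ (beta - 4)
  * (a_coef n beta * enorm (defect u x) ^+ 2
     + beta * w x * kato_deficit (fun i j => u2 i j x) (u1^~ x)).
Proof.
move=> Ux.
have pu i : partial i u x = u1 i x by rewrite (gu Ux).2.
rewrite defect_sqr // Ffun_z // (enorm_grad_powR _ pu) /divergence.
have -> : (beta - 4) / 2 = beta / 2 - 2.
  by field.
rewrite -/(q x) /kato_deficit -/(w x) -/(b2 x) -/(h2 x) /a_coef -/N.
have gz : hasgrad z x (fun i => - K * z x / u x * u1 i x).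
  exact: (grad_pow (- K) (u0 Ux) (gu Ux)).
have gq : hasgrad q x (fun i => (beta / 2 - 2) * q x / w x * (2 * B i x)).
  exact: (grad_pow (beta / 2 - 2) (w0 Ux) (grad_w Ux)).
pose f1 := c * u x + d.
rewrite (eq_bigr (fun i => z x * q x * (
     (- K / u x * beta * (f1 * u x) * w x + (beta - 4) / w x * (d - K * f1) * w x ^+ 2
      + beta * (2 * c * u x + d) * w x + 4 * w x * (d - K * f1)) * (B i x * u1 i x)
   + (- K / u x * (d - K * f1) * w x ^+ 2 - K * c * w x ^+ 2) * u1 i x ^+ 2
   + ((beta - 4) * beta * (f1 * u x) + 2 * beta * (f1 * u x)) * B i x ^+ 2
   + beta * (f1 * u x) * w x * (\sum_j (u3 i j i x * u1 j x + u2 i j x * u2 j i x))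
   + (d - K * f1) * w x ^+ 2 * u2 i i x))); last first.
  move=> i _.
  have gcu : hasgrad (fun y => c * u y + d) x (fun i => c * u1 i x).
    apply: (hasgrad_eq (hasgradD (hasgradZ c (gu Ux)) (hasgrad_cst d x))) => k.
    by rewrite addr0.
  have gP := hasgradM (hasgradM gz gq)
    (hasgradD (hasgradM (hasgradM (hasgradZ beta (hasgradM gcu (gu Ux))) (grad_w Ux))
                        (grad_B i Ux))
              (hasgradM (hasgradM (hasgradB (hasgrad_cst d x) (hasgradZ K gcu))
                                  (hasgradX 2 (grad_w Ux))) (gu1 i Ux))).
  have e : \forall y \near x, Phi i y = flux beta c d u y ord0 i.
    by apply: (near_open oU Ux) => y Uy; rewrite flux_coord.
  rewrite (hasgrad_near e gP).2.
  rewrite /f1 /= expr1; move: (\sum_j _) (B i x) (z x) (q x) K (w0 Ux) (u0 Ux).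
  move=> S b t s k wx ux; field.
  by rewrite !gt_eqF.
rewrite -mulr_sumr !big_split /= -!mulr_sumr div_B // u2tr //.
rewrite -/(b2 x) -/(w x) -/(bu x) /f1 /K.
have := w0 Ux; have := u0 Ux.
move: (z x) (q x) (w x) (b2 x) (bu x) (h2 x) (u x) => t s W b4 bb hh ux ux0 W0.
by field; rewrite !gt_eqF.
Qed.

End FluxDivergence.

Section PotentialFlux.
Variables (R : realType) (n : nat) (Omega : set 'rV[R]_n) (u : 'rV[R]_n -> R).
Hypothesis n3 : (3 <= n)%N.
Hypothesis oOmega : open Omega.
Hypothesis hu : electrostatic_potential Omega u.
Implicit Types (x y z : 'rV[R]_n).

Let E := ~` closure Omega.
Let U := ~` (closure Omega `|` Crit u).
Let n0 : (0 < n)%N. Proof. by rewrite (leq_trans _ n3). Qed.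

Definition hess i j x := partial j (partial i u) x.

Lemma regularP x : U x <-> E x /\ ~ Crit u x.
Proof. by rewrite /U setCU. Qed.

Lemma hasgrad_u x : E x -> hasgrad u x (fun i => partial i u x).
Proof.
by move=> Ex; apply: hasgrad_partial; have [h _] := potential_Ck hu 1; exact: h.
Qed.

Lemma hasgrad_partial_u i x : E x -> hasgrad (partial i u) x (fun j => hess i j x).
Proof.
move=> Ex; apply: hasgrad_partial; have [_ /(_ i)[h _]] := potential_Ck hu 2.
exact: h.
Qed.

Lemma hasgrad_hess i j x : E x ->
  hasgrad (hess i j) x (fun k => partial k (hess i j) x).
Proof.
move=> Ex; apply: hasgrad_partial.
by have [_ /(_ i)[_ /(_ j)[h _]]] := potential_Ck hu 3; exact: h.
Qed.

Lemma hessC i j x : E x -> hess i j x = hess j i x.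
Proof.
move=> Ex; exact: (partialC j i (@exterior_open R n Omega) (potential_Ck hu 2) Ex).
Qed.

Lemma hess_trace x : E x -> \sum_i hess i i x = 0.
Proof. by move=> Ex; have [_ lu _ _] := hu; exact: lu. Qed.

Lemma hess_diff_trace i x : E x -> \sum_k partial k (hess k i) x = 0.
Proof.
move=> Ex.
have oE := @exterior_open R n Omega.
transitivity (\sum_k partial i (hess k k) x).
  apply: eq_bigr => k _.
  have [_ /(_ k) h] := potential_Ck hu 3.
  exact: (partialC k i oE h Ex).
have g := hasgrad_sum (index_enum 'I_n) predT (fun k => hasgrad_hess k k Ex).
have e : \forall y \near x, \sum_k hess k k y = 0.
  by apply: (near_open oE Ex) => y Ey; exact: hess_trace.
rewrite -((hasgrad_near e g).2 i).
exact: (hasgrad_cst 0 x).2.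
Qed.

Lemma sqnorm_grad x : sqnorm (grad u x) = \sum_i partial i u x ^+ 2.
Proof. by apply: eq_bigr => i _; rewrite mxE. Qed.

Lemma sqnorm_grad_continuous x : E x -> {for x, continuous (fun y => sqnorm (grad u y))}.
Proof.
move=> Ex; apply: differentiable_continuous.
have -> : (fun y => sqnorm (grad u y)) = (fun y => \sum_i partial i u y ^+ 2).
  by apply/funext => y; exact: sqnorm_grad.
by have [] := hasgrad_sum (index_enum _) predT
  (fun k => hasgradX 2 (hasgrad_partial_u k Ex)).
Qed.

Lemma regular_open : open U.
Proof.
rewrite openE => x /regularP[Ex nx].
have wx : 0 < sqnorm (grad u x).
  by rewrite lt_neqAle eq_sym sqnorm_eq0 sqnorm_ge0 andbT; apply/eqP.
have nE : nbhs x E by apply: open_nbhs_nbhs; split=> //; exact: exterior_open.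
have nw : \forall y \near x, 0 < sqnorm (grad u y).
  by move: (sqnorm_grad_continuous Ex) => /cvgr_gt/(_ _ wx).
move: nE nw; apply: filterS2 => y Ey wy; apply/regularP; split=> // cy.
by move: wy; rewrite cy lt_neqAle eq_sym sqnorm_eq0 eqxx.
Qed.

Lemma regular_gt0 x : U x -> 0 < \sum_i partial i u x ^+ 2.
Proof.
move=> /regularP[Ex nx]; rewrite -sqnorm_grad lt_neqAle eq_sym sqnorm_eq0 sqnorm_ge0 andbT.
exact/eqP.
Qed.

Lemma regular_bounds x : U x -> 0 < u x < 1.
Proof. by move=> /regularP[Ex nx]; exact: (potential_strict n0 oOmega hu). Qed.

Definition deficit x := kato_deficit (fun i j => hess i j x) (fun i => partial i u x).

Lemma deficit_ge0 x : U x -> 0 <= deficit x.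
Proof.
move=> Ux; have [Ex _] := (regularP x).1 Ux.
apply: kato_deficit_ge0; first exact: ltnW.
- by move=> i j; exact: hessC.
- exact: hess_trace.
- exact: regular_gt0.
Qed.

Lemma divergence_fluxE (beta c d : R) x : U x ->
  divergence (flux beta c d u) x =
  Ffun n beta c d (u x) * enorm (grad u x) `^ (beta - 4)
  * (a_coef n beta * enorm (defect u x) ^+ 2 + beta * sqnorm (grad u x) * deficit x).
Proof.
move=> Ux; rewrite sqnorm_grad.
have h1 y : U y -> hasgrad u y (fun i => partial i u y).
  by move=> /regularP[Ey _]; exact: hasgrad_u.
have h2 i y : U y -> hasgrad (partial i u) y (fun j => hess i j y).
  by move=> /regularP[Ey _]; exact: hasgrad_partial_u.
have h3 i j y : U y -> hasgrad (hess i j) y (fun k => partial k (hess i j) y).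
  by move=> /regularP[Ey _]; exact: hasgrad_hess.
have h4 i j y : U y -> hess i j y = hess j i y.
  by move=> /regularP[Ey _]; exact: hessC.
have h5 y : U y -> \sum_i hess i i y = 0.
  by move=> /regularP[Ey _]; exact: hess_trace.
have h6 i y : U y -> \sum_k partial k (hess k i) y = 0.
  by move=> /regularP[Ey _]; exact: hess_diff_trace.
have h7 y : U y -> 0 < u y by move=> /regular_bounds/andP[].
have h := @divergence_flux R n U u (fun i => partial i u) hess
  (fun i j k => partial k (hess i j)) n3 regular_open h1 h2 h3 h4 h5 h6 beta c d
  regular_gt0 h7 x Ux.
by rewrite h.
Qed.

Lemma defect_sqrE x : U x ->
  let b i := \sum_j hess i j x * partial j u x in
  enorm (defect u x) ^+ 2 = 4 * (\sum_i b i ^+ 2)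
   - 8 * ((n%:R - 1) / (n%:R - 2)) * (sqnorm (grad u x) / u x)
     * (\sum_i b i * partial i u x)
   + 4 * ((n%:R - 1) / (n%:R - 2)) ^+ 2 * (sqnorm (grad u x) ^+ 3 / u x ^+ 2).
Proof.
move=> Ux b; rewrite sqnorm_grad.
have h1 y : U y -> hasgrad u y (fun i => partial i u y).
  by move=> /regularP[Ey _]; exact: hasgrad_u.
have h2 i y : U y -> hasgrad (partial i u) y (fun j => hess i j y).
  by move=> /regularP[Ey _]; exact: hasgrad_partial_u.
have h4 i j y : U y -> hess i j y = hess j i y.
  by move=> /regularP[Ey _]; exact: hessC.
have h7 y : U y -> 0 < u y by move=> /regular_bounds/andP[].
exact: (@defect_sqr R n U u (fun i => partial i u) hess n3 regular_open h1 h2 h4 h7 x Ux).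
Qed.

Lemma Ffun_ge0 (beta c d t : R) : 0 <= c + d -> 0 <= d -> 0 <= t <= 1 ->
  0 <= Ffun n beta c d t.
Proof.
move=> cd d0 /andP[t0 t1]; rewrite mulr_ge0 ?powR_ge0 //.
have -> : c * t + d = (c + d) * t + d * (1 - t) by ring.
by rewrite addr_ge0 ?mulr_ge0 // subr_ge0.
Qed.

Lemma Ffun_gt0 (beta c d t : R) : 0 <= c + d -> 0 <= d -> ~ (c = 0 /\ d = 0) ->
  0 < t < 1 -> 0 < Ffun n beta c d t.
Proof.
move=> cd d0 ncd /andP[t0 t1]; rewrite mulr_gt0 ?powR_gt0 //.
have -> : c * t + d = (c + d) * t + d * (1 - t) by ring.
have [d0'|dn] := eqVneq d 0.
  rewrite d0' addr0 mul0r addr0 mulr_gt0 //.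
  rewrite lt_neqAle; move: cd; rewrite d0' addr0 => ->; rewrite andbT.
  by apply/eqP => c0; apply: ncd; rewrite d0' -c0.
by rewrite ltr_wpDl ?mulr_gt0 ?mulr_ge0 ?subr_gt0 ?(ltW t0) // lt_neqAle eq_sym dn.
Qed.

End PotentialFlux.

Section RoundBall.
Variables (R : realType) (n : nat) (p : 'rV[R]_n) (r : R).
Hypothesis n3 : (3 <= n)%N.
Hypothesis r0 : 0 < r.
Implicit Types (x y z : 'rV[R]_n).

Let Omega := [set x | enorm (x - p) < r].
Let E := ~` closure Omega.
Let N : R := n%:R.
Let S x := sqnorm (x - p).

Let N2 : 1 <= N - 2.
Proof. by rewrite lerBrDr -natr1 -(natrD R 1 2) ler_nat. Qed.

Let continuous_S : continuous S.
Proof.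
by move=> x; apply: differentiable_continuous; have [] := hasgrad_sqnorm p x.
Qed.

Let OmegaE x : Omega x <-> S x < r ^+ 2.
Proof. by rewrite /Omega /S /= -enorm_sqr ltr_pXn2r // nnegrE ?enorm_ge0 ?ltW. Qed.

Lemma ball_open : open Omega.
Proof.
have -> : Omega = S @^-1` [set t | t < r ^+ 2] by apply/seteqP; split=> x /OmegaE.
by apply: open_comp; [move=> x _; exact: continuous_S|exact: open_lt].
Qed.

Let S_notin x : ~ Omega x -> r ^+ 2 <= S x.
Proof. by move=> /OmegaE/negP; rewrite -leNgt. Qed.

Let S_gt0 x : ~ Omega x -> 0 < S x.
Proof. by move=> /S_notin; apply: lt_le_trans; exact: exprn_gt0. Qed.

Let S_boundary x : boundary Omega x -> S x = r ^+ 2.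
Proof.
move=> bx; apply/eqP; rewrite eq_le S_notin ?andbT; last first.
  exact: (boundary_notin ball_open).
have [cx _] := bx.
have : closed (S @^-1` [set t | t <= r ^+ 2]).
  by apply: preimage_closed; [move=> y _; exact: continuous_S|exact: closed_le].
move=> /closure_id h.
suff : (S @^-1` [set t | t <= r ^+ 2]) x by [].
by rewrite h; apply: closure_subset cx => y /OmegaE /= /ltW.
Qed.

Let a : R := 1 - N / 2.
Let C := ((r ^+ 2) `^ a)^-1.
Let v x := C * S x `^ a.
Let lam x := 2 * a * C * S x `^ (a - 1).

Let C0 : 0 < C. Proof. by rewrite invr_gt0 powR_gt0 // exprn_gt0. Qed.

Let Pstep x : 0 < S x -> S x `^ a = S x * S x `^ (a - 1).
Proof.
by move=> S0; rewrite -powR_addr1 // subrK.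
Qed.

Let vE x : 0 < S x -> v x = C * S x * S x `^ (a - 1).
Proof. by move=> S0; rewrite /v Pstep // mulrA. Qed.

Let grad_v x : 0 < S x -> hasgrad v x (fun i => lam x * (x - p) ord0 i).
Proof.
move=> S0.
apply: (hasgrad_eq (hasgradZ C (hasgrad_powR a S0 (hasgrad_sqnorm p x)))) => i.
rewrite /lam -/(S x); move: (S x `^ _) (_ ord0 i) => t s; ring.
Qed.

Let grad_lam x : 0 < S x -> hasgrad lam x (fun i => - N * lam x / S x * (x - p) ord0 i).
Proof.
move=> S0.
apply: (hasgrad_eq (hasgradZ (2 * a * C) (hasgrad_powR (a - 1) S0 (hasgrad_sqnorm p x)))) => i.
rewrite /lam -/(S x).
have -> : S x `^ (a - 1) = S x * S x `^ (a - 1 - 1).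
  by rewrite -powR_addr1 // subrK.
move: (S x `^ _) (_ ord0 i) => t s; rewrite /a; field.
by rewrite gt_eqF.
Qed.

Let d2v i j x := lam x * ((i == j)%:R - N * ((x - p) ord0 i * (x - p) ord0 j) / S x).

Let grad2_v i x : 0 < S x -> hasgrad (fun y => lam y * (y - p) ord0 i) x (fun j => d2v i j x).
Proof.
move=> S0; apply: (hasgrad_eq (hasgradM (grad_lam S0) (hasgrad_coord_sub p x i))) => j.
rewrite /d2v; move: (lam x) ((x - p) ord0 i) ((x - p) ord0 j) => l s t.
by field; rewrite gt_eqF.
Qed.

Let S_E x : E x -> 0 < S x.
Proof. by move=> Ex; apply: S_gt0; exact: exterior_notin. Qed.

Let v_twice : twice_differentiable E v /\
  forall x i j, E x -> partial j (partial i v) x = d2v i j x.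
Proof.
apply: (@twice_differentiable_hasgrad R n E v (fun i y => lam y * (y - p) ord0 i)).
- exact: exterior_open.
- by move=> x Ex; apply: grad_v; exact: S_E.
- by move=> i x Ex; apply: grad2_v; exact: S_E.
Qed.

Let v_harmonic x : E x -> laplacian v x = 0.
Proof.
move=> Ex; rewrite /laplacian.
rewrite (eq_bigr (fun i => lam x - lam x * N / S x * (x - p) ord0 i ^+ 2)).
  rewrite big_split /= sumr_const sumrN -mulr_sumr -/(sqnorm (x - p)) -/(S x).
  rewrite card_ord -[lam x *+ n]mulr_natl -/N.
  by move: (lam x) => l; field; rewrite gt_eqF // S_E.
move=> i _; rewrite v_twice.2 // /d2v eqxx mulr1n.
move: (lam x) (_ ord0 i) => l s; field.
by rewrite gt_eqF // S_E.
Qed.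

Let v_continuous : {within ~` Omega, continuous v}.
Proof.
apply/subspace_continuousP => x Ox; apply: cvg_within_filter.
exact: (differentiable_continuous (grad_v (S_gt0 Ox)).1).
Qed.

Let v_boundary x : boundary Omega x -> v x = 1.
Proof.
move=> /S_boundary e; rewrite /v e mulVf // gt_eqF // powR_gt0 // exprn_gt0 //.
Qed.

Let v_ge0 x : 0 <= v x. Proof. by rewrite mulr_ge0 ?powR_ge0 // ltW. Qed.

Let v_infty (e : R) : 0 < e -> exists M : R, forall x, M < enorm x -> v x <= e.
Proof.
move=> e0; pose T := 1 + (C / e) ^+ 2.
have T1 : 1 <= T by rewrite lerDl sqr_ge0.
pose M := 2 * (T + sqnorm p).
have M1 : 1 <= M by have := sqnorm_ge0 p; rewrite /M; move: (sqnorm p) => s; lra.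
exists M => x Mx.
have Mx2 : M <= sqnorm x.
  rewrite -enorm_sqr (@le_trans _ _ (M ^+ 2)) //.
    by rewrite expr2 ler_peMl // (le_trans ler01).
  by rewrite ler_pXn2r ?nnegrE ?enorm_ge0 ?(ltW Mx) // (le_trans ler01).
have ST : T <= S x.
  have : sqnorm x <= 2 * S x + 2 * sqnorm p.
    by rewrite -{1}(subrK p x); exact: sqnormD_le.
  by move: Mx2; rewrite /M; move: (sqnorm x) (sqnorm p) (S x) => s t q; lra.
have S1 : 1 <= S x := le_trans T1 ST.
have S0 : 0 < S x := lt_le_trans ltr01 S1.
have ha : S x `^ a <= S x `^ (- 2^-1).
  by apply: ler_powR => //; rewrite /a; move: N2; move: N => k; lra.
rewrite /v (le_trans (ler_wpM2l (ltW C0) ha)) //.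
rewrite powRN powR12_sqrt ?(ltW S0) // ler_pdivrMr ?sqrtr_gt0 //.
rewrite mulrC -ler_pdivrMr // -(@ler_pXn2r _ 2) ?nnegrE ?sqrtr_ge0 ?divr_ge0 ?(ltW C0) ?(ltW e0) //.
rewrite sqr_sqrtr ?(ltW S0) // (le_trans _ ST) // lerDr ler01 //.
Qed.

Variable u : 'rV[R]_n -> R.
Hypothesis hu : electrostatic_potential Omega u.
Let n0 : (0 < n)%N. Proof. by rewrite (leq_trans _ n3). Qed.

Let uE x : ~ Omega x -> u x = v x.
Proof.
move=> Ox.
have cmp := potential_compare n0 ball_open hu v_continuous v_twice.1 v_harmonic.
apply/eqP; rewrite eq_le -subr_le0 -[X in _ && X]subr_le0; apply/andP; split.
  rewrite -[u x]mul1r -mulN1r; apply: cmp => //.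
    by move=> y /v_boundary ->; rewrite mulr1 subrr.
  move=> e e0; exists 0 => y _ _; rewrite add0r mulN1r.
  by rewrite (@le_trans _ _ 0) ?oppr_le0 // ltW.
rewrite addrC -[v x]mul1r -mulN1r; apply: cmp => //.
  by move=> y /v_boundary ->; rewrite mulr1 addNr.
move=> e /v_infty[M hM]; exists M => y _ /hM.
by rewrite mul1r add0r.
Qed.

Let U := ~` (closure Omega `|` Crit u).

Let near_u x : E x -> \forall y \near x, v y = u y.
Proof.
move=> Ex; apply: (near_open (@exterior_open R n Omega) Ex) => y Ey.
by rewrite uE //; exact: exterior_notin.
Qed.

Let partial_u i x : E x -> partial i u x = lam x * (x - p) ord0 i.
Proof. by move=> Ex; rewrite (hasgrad_near (near_u Ex) (grad_v (S_E Ex))).2. Qed.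

Let hess_u i j x : E x -> hess u i j x = d2v i j x.
Proof.
move=> Ex; rewrite /hess; apply: (hasgrad_near _ (grad2_v i (S_E Ex))).2.
by apply: (near_open (@exterior_open R n Omega) Ex) => y Ey; rewrite partial_u.
Qed.

Lemma ball_divergence_eq0 (beta c d : R) x : U x ->
  divergence (flux beta c d u) x = 0.
Proof.
move=> Ux; have [Ex _] := (@regularP R n Omega u x).1 Ux.
have S0 := S_E Ex.
have w0 := regular_gt0 Ux.
have wE : \sum_i partial i u x ^+ 2 = lam x ^+ 2 * S x.
  rewrite /S /sqnorm mulr_sumr; apply: eq_bigr => i _.
  by rewrite partial_u // exprMn.
have lam0 : lam x != 0.
  by apply/eqP => l0; move: w0; rewrite wE l0 expr0n mul0r ltxx.
have hessE i j : hess u i j x = lam x * ((i == j)%:R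
    - N * (partial i u x * partial j u x) / \sum_i partial i u x ^+ 2).
  rewrite wE hess_u // !partial_u // /d2v.
  move: (lam x) lam0 (_ ord0 i) (_ ord0 j) => l l0 s t.
  by field; rewrite l0 gt_eqF.
have D0 : deficit u x = 0.
  exact: (@kato_equality _ _ _ _ (ltnW n3) w0 (lam x)).
have T0 : enorm (defect u x) ^+ 2 = 0.
  rewrite (defect_sqrE n3 ball_open hu Ux) sqnorm_grad.
  have bE i : \sum_j hess u i j x * partial j u x = lam x * (1 - N) * partial i u x.
    rewrite (eq_bigr (fun j => (i == j)%:R * (lam x * partial j u x)
        - lam x * N / (\sum_i partial i u x ^+ 2) * partial i u x * partial j u x ^+ 2)).
      rewrite big_split /= sumrN sum_delta -mulr_sumr.
      move: (\sum_i _) w0 (partial i u x) => W W0 s.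
      by field; rewrite gt_eqF.
    move=> j _; rewrite hessE; move: (\sum_i _) w0 (partial i u x) (partial j u x) => W W0 s t.
    by field; rewrite gt_eqF.
  rewrite (eq_bigr (fun i => (lam x * (1 - N)) ^+ 2 * partial i u x ^+ 2)); last first.
    by move=> i _; rewrite bE exprMn.
  rewrite [X in _ - _ * X](eq_bigr (fun i => lam x * (1 - N) * partial i u x ^+ 2)); last first.
    by move=> i _; rewrite bE -mulrA -expr2.
  rewrite -!mulr_sumr wE uE; last exact: exterior_notin.
  rewrite vE // /lam -/N /a; have P0 : 0 < S x `^ (a - 1) by exact: powR_gt0.
  move: (S x `^ _) P0 => t t0; field.
  by rewrite !gt_eqF // (lt_le_trans ltr01).
by rewrite (divergence_fluxE n3 ball_open hu) // D0 T0 !mulr0 addr0 mulr0.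
Qed.

End RoundBall.

Section Topology.
Variables (R : realType) (n : nat).
Implicit Types (x y z v p : 'rV[R]_n) (A D : set 'rV[R]_n) (f g : 'rV[R]_n -> R).

Lemma connected_clopen A D : connected A -> D `<=` A -> D !=set0 ->
  (forall x, D x -> nbhs x D) -> (forall x, A x -> closure D x -> D x) -> D = A.
Proof.
move=> cA DA D0 oD cD; apply: cA => //.
  exists D; first by rewrite openE => x /oD.
  by rewrite setIidr.
exists (closure D); first exact: closed_closure.
apply/seteqP; split=> [x Dx|x [Ax cx]]; last exact: cD.
by split; [exact: DA|exact: subset_closure].
Qed.

Lemma closure_continuous_eq D f (c : R) x : closure D x ->
  {for x, continuous f} -> (forall y, D y -> f y = c) -> f x = c.
Proof.
move=> cx cf fc; apply/eqP; rewrite -subr_eq0 -normr_le0 leNgt; apply/negP => e0.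
have /cvgrPdist_lt/(_ _ e0) h := cf.
have [y [Dy hy]] := cx _ h.
by move: hy; rewrite /= (fc y Dy) ltxx.
Qed.

Lemma continuous_at_mul f g x : {for x, continuous f} -> {for x, continuous g} ->
  {for x, continuous (fun y => f y * g y)}.
Proof. by move=> cf cg; exact: (cvgM cf cg). Qed.

Lemma continuous_at_cst (c : R) x : {for x, continuous (fun=> c : R)}.
Proof. exact: (differentiable_continuous (differentiable_cst c x)). Qed.

Lemma continuous_at_sqnormX p k x : {for x, continuous (fun y => sqnorm (y - p) ^+ k)}.
Proof. exact: (differentiable_continuous (hasgradX k (hasgrad_sqnorm p x)).1). Qed.

Lemma connected_constant A f : open A -> connected A ->
  (forall x, A x -> hasgrad f x (fun=> 0)) ->
  forall x y, A x -> A y -> f x = f y.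
Proof.
move=> oA cA gf x y Ax Ay.
pose D := [set z | A z /\ f z = f y].
suff : D x by case.
suff -> : D = A by [].
apply: connected_clopen => //.
- by move=> z [].
- by exists y.
- move=> z [Az fz]; have [e e0 he] := open_ball_sub oA Az.
  apply/nbhs_ballP; exists e => // t; rewrite -ball_normE /= => zt.
  split; first exact: he.
  by rewrite (ball_constant (fun t zt => gf t (he t zt)) zt).
- move=> z Az cz; split=> //.
  apply: (closure_continuous_eq cz); last by move=> t [].
  exact/differentiable_continuous/(gf z Az).1.
Qed.

Lemma ray_far p v (T : R) : v != 0 ->
  exists t, [/\ 1 <= t, T < sqnorm (t *: v + p) & T < t * sqnorm v].
Proof.
move=> v0; have nv : 0 < sqnorm v by rewrite lt_neqAle eq_sym sqnorm_eq0 v0 sqnorm_ge0.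
have np := sqnorm_ge0 p.
pose t := 1 + (2 * (`|T| + sqnorm p) + 1) / sqnorm v.
have t1 : 1 <= t by rewrite lerDl divr_ge0 ?(ltW nv) // !addr_ge0 // mulr_ge0 // addr_ge0.
have tv : 2 * (`|T| + sqnorm p) + 1 <= t * sqnorm v.
  by rewrite /t [leRHS]mulrDl divfK ?gt_eqF // lerDr mul1r ltW.
have TT : T <= `|T| by exact: ler_norm.
have T0 : 0 <= `|T| by [].
exists t; split=> //; last by move: tv; move: (t * _) (sqnorm p) np `|T| TT T0 => a b b0 c d e; lra.
have h : sqnorm (t *: v) <= 2 * sqnorm (t *: v + p) + 2 * sqnorm p.
  by rewrite -{1}(addrK p (t *: v)) -[in X in _ <= _ + X]sqnormN; exact: sqnormD_le.
have tt : t * sqnorm v <= sqnorm (t *: v).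
  by rewrite sqnormZ ler_wpM2r ?(ltW nv) // expr2 ler_peMl // (le_trans ler01).
move: h tt tv; move: (sqnorm (t *: v)) (sqnorm (t *: v + p)) (t * _) (sqnorm p) np `|T| TT T0 => *.
lra.
Qed.

Variable Omega : set 'rV[R]_n.
Hypothesis oOmega : open Omega.
Hypothesis bOmega : bounded_set Omega.

Lemma exterior_far : exists M : R, forall x, M < sqnorm x -> (~` closure Omega) x.
Proof.
have [M0 [_ hM0]] := bOmega.
pose M := Num.max M0 0 + 1.
have M1 : 0 <= M by rewrite addr_ge0 // le_max lexx orbT.
have MM : M0 < M by rewrite (@le_lt_trans _ _ (Num.max M0 0)) ?ltrDl // le_max lexx.
exists (n%:R * M ^+ 2) => x hx cx.
have cl : closed [set y : 'rV[R]_n | `|y| <= M].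
  rewrite (_ : [set _ | _] = (fun y : 'rV[R]_n => `|y|) @^-1` [set t | t <= M]) //.
  by apply: preimage_closed; [move=> y _; exact: norm_continuous|exact: closed_le].
have : [set y : 'rV[R]_n | `|y| <= M] x.
  rewrite ((closure_id _).1 cl); apply: closure_subset cx => y Oy /=.
  exact: hM0.
move=> /= xM; move: hx; rewrite ltNge => /negP; apply.
apply: (le_trans (sqnorm_le_norm x)); rewrite ler_wpM2l //.
by rewrite ler_pXn2r // nnegrE.
Qed.

Lemma ray_exit x v : Omega x -> v != 0 ->
  exists2 t, 0 < t & boundary Omega (t *: v + x).
Proof.
move=> Ox v0; have [M hM] := exterior_far.
have [t1 [t11 ht1 _]] := ray_far x M v0.
apply: contrapT => nb0.
have nb t : 0 < t -> ~ boundary Omega (t *: v + x) by move=> t0 bt; apply: nb0; exists t.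
have nb' t : 0 <= t -> ~ boundary Omega (t *: v + x).
  rewrite le_eqVlt => /predU1P[<-|]; last exact: nb.
  by rewrite scale0r add0r => /(boundary_notin oOmega).
have cl := @continuous_line R n x v.
have D : `[0, t1]%classic `&` (fun t : R => t *: v + x) @^-1` Omega = `[0, t1]%classic.
  apply: (@segment_connected R 0 t1).
  - by exists 0; split; rewrite /= ?in_itv /= ?lexx ?(le_trans ler01) // scale0r add0r.
  - exists ((fun t : R => t *: v + x) @^-1` Omega) => //.
    by apply: open_comp => // t _; exact: cl.
  - exists ((fun t : R => t *: v + x) @^-1` closure Omega).
      by apply: preimage_closed => [t _|]; [exact: cl|exact: closed_closure].
    apply/seteqP; split=> t [tI Ot]; split=> //; first exact: subset_closure.
    have [//|nO] := pselect (Omega (t *: v + x)).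
    have [] := complement_cases oOmega nO => // bt.
    by exfalso; apply: (nb' t) bt; move: tI; rewrite /= in_itv /= => /andP[].
have : (`[0, t1]%classic : set R) t1 by rewrite /= in_itv /= lexx (le_trans ler01).
rewrite -D => -[_ /= /subset_closure]; exact: hM.
Qed.

Hypothesis sOmega : smooth_boundary Omega.

(* A boundary point not approached from the exterior would be a local maximum
   of the defining function. *)
Lemma boundary_closure_exterior x : boundary Omega x ->
  closure (~` closure Omega) x.
Proof.
move=> bx; have [U [rho [oU Ux srho grho hrho]]] := sOmega bx.
move=> W nW; apply: contrapT => hW.
have WE y : W y -> closure Omega y by move=> Wy; apply: contrapT => ny; apply: hW; exists y.
have [drho _] := srho 1.
have rx : 0 <= rho x.
  by rewrite leNgt; apply/negP => /(hrho x Ux).2; exact: (boundary_notin oOmega).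
have rmax : \forall y \near x, rho y <= rho x.
  have nU : nbhs x U by exact: open_nbhs_nbhs.
  move: nW nU; apply: filterS2 => y Wy Uy; apply: le_trans rx.
  rewrite leNgt; apply/negP => ry.
  have nry : \forall z \near y, 0 < rho z.
    by move: (differentiable_continuous (drho y Uy)) => /cvgr_gt/(_ _ ry).
  have nUy : nbhs y U by exact: open_nbhs_nbhs.
  have [z [Oz /= [rz Uz]]] := WE y Wy _ (filterI nry nUy).
  by move/(hrho z Uz).1: Oz; rewrite ltNge (ltW rz).
have /negP := grho x Ux; apply; apply/eqP/rowP => i; rewrite !mxE.
exact: (local_max_partial i oU Ux drho rmax).
Qed.

Variable u : 'rV[R]_n -> R.
Hypothesis hu : electrostatic_potential Omega u.

Lemma potential_boundary_limit x : boundary Omega x ->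
  exists (g : 'rV[R]_n -> R) D, [/\ {for x, continuous g}, g x = 1, closure D x,
    D `<=` ~` closure Omega & forall y, D y -> u y = g y].
Proof.
move=> bx; have [su _ ub _] := hu.
have nx := boundary_notin oOmega bx.
have [U [g [oU Ux sg e]]] := su x nx.
exists g, (~` closure Omega `&` U); split.
- exact: (sg 0).
- by rewrite -e // ub.
- have nU : nbhs x U by exact: open_nbhs_nbhs.
  move=> W nW; have [y [Ey [Wy Uy]]] := boundary_closure_exterior bx (filterI nW nU).
  by exists y; split.
- by move=> y [].
- by move=> y [Ey Uy]; apply: e => //; exact: exterior_notin.
Qed.

Lemma potential_far (e : R) : 0 < e -> exists M : R, forall x, M < sqnorm x ->
  (~` closure Omega) x /\ `|u x| < e.
Proof.
move=> e0; have [_ _ _ iu] := hu.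
have [M1 h1] := iu e e0; have [M2 h2] := exterior_far.
exists (Num.max M2 (Num.max M1 0 ^+ 2)) => x; rewrite gt_max => /andP[x2 x1].
have Ex := h2 x x2; split=> //; apply: h1; first exact: exterior_notin.
rewrite ltNge; apply/negP => xM; move: x1; rewrite ltNge => /negP; apply.
by rewrite -enorm_le ?le_max ?xM // lexx orbT.
Qed.

End Topology.

Section FirstIntegrals.
Variables (R : realType) (n : nat) (Omega : set 'rV[R]_n) (u : 'rV[R]_n -> R).
Hypothesis n3 : (3 <= n)%N.
Hypothesis oOmega : open Omega.
Hypothesis hu : electrostatic_potential Omega u.
Let E := ~` closure Omega.
Let U := ~` (closure Omega `|` Crit u).
Hypothesis D0 : forall x, U x -> deficit u x = 0.
Implicit Types (x y z p : 'rV[R]_n).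

Let N : R := n%:R.
Let ui i x := partial i u x.
Let w x := \sum_i ui i x ^+ 2.
Let B i x := \sum_j hess u i j x * ui j x.

(* For a trace-free Hessian with equality in Kato's inequality, the eigenvalue
   on the orthogonal complement of Du. *)
Definition eigen x := - ((\sum_i B i x * ui i x) / ((N - 1) * w x)).

Let N2 : 0 < N - 2. Proof. by rewrite subr_gt0 ltr_nat. Qed.
Let N1 : 0 < N - 1. Proof. by rewrite subr_gt0 ltr1n ltnW. Qed.
Let oU : open U. Proof. exact: (regular_open hu). Qed.
Let UE x : U x -> E x. Proof. by move=> /regularP[]. Qed.
Let w0 x : U x -> 0 < w x. Proof. exact: regular_gt0. Qed.

Lemma hess_eigen i j x : U x ->
  hess u i j x = eigen x * ((i == j)%:R - N * (ui i x * ui j x) / w x).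
Proof.
move=> Ux; have Ex := UE Ux.
exact: (@kato_deficit_eq0 R n (fun i j => hess u i j x) (fun i => partial i u x)
  (ltnW n3) (fun k l => hessC hu k l Ex) (hess_trace hu Ex) (w0 Ux) n3 (D0 Ux) i j).
Qed.

Lemma B_eigen i x : U x -> B i x = eigen x * (1 - N) * ui i x.
Proof.
move=> Ux; rewrite /B (eq_bigr (fun j => (i == j)%:R * (eigen x * ui j x)
        - eigen x * N / w x * ui i x * ui j x ^+ 2)).
  rewrite big_split /= sumrN sum_delta -mulr_sumr -/(w x).
  move: (w x) (w0 Ux) (eigen x) (ui i x) => W W0 l s.
  by field; rewrite gt_eqF.
move=> j _; rewrite hess_eigen //.
move: (w x) (w0 Ux) (eigen x) (ui i x) (ui j x) => W W0 l s t.
by field; rewrite gt_eqF.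
Qed.

Let gui i x : E x -> hasgrad (ui i) x (fun j => hess u i j x).
Proof. exact: (hasgrad_partial_u hu). Qed.

Let gw x : U x -> hasgrad w x (fun i => 2 * (eigen x * (1 - N)) * ui i x).
Proof.
move=> Ux; have Ex := UE Ux.
apply: (hasgrad_eq (hasgrad_sum (index_enum _) predT
  (fun k => hasgradX 2 (gui k Ex)))) => i.
rewrite -mulrA -B_eigen // /B mulr_sumr; apply: eq_bigr => j _ /=.
rewrite (hessC hu i j Ex) expr1; move: (ui j x) (hess u j i x) => s t; ring.
Qed.

Let eigen_diff x : U x -> differentiable eigen x.
Proof.
move=> Ux; have Ex := UE Ux.
have gB i : hasgrad (B i) x _ := hasgrad_sum (index_enum _) predT
  (fun j => hasgradM (hasgrad_hess hu i j Ex) (gui j Ex)).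
have gn : hasgrad (fun y => \sum_i B i y * ui i y) x _ :=
  hasgrad_sum (index_enum _) predT (fun i => hasgradM (gB i) (gui i Ex)).
have nz : (N - 1) * w x != 0 by rewrite mulf_neq0 // gt_eqF // w0.
exact: (hasgradN (hasgradM gn (hasgradV nz (hasgradZ (N - 1) (gw Ux))))).1.
Qed.

(* The trace of the third derivatives vanishes and determines the gradient of
   [eigen]. *)
Lemma grad_eigen x : U x ->
  hasgrad eigen x (fun i => - N * eigen x ^+ 2 / w x * ui i x).
Proof.
move=> Ux; have Ex := UE Ux.
have gl := hasgrad_partial (eigen_diff Ux).
apply: (hasgrad_eq gl) => i.
pose l k := partial k eigen x.
have gF k j : hasgrad (hess u k j) x (fun m =>
   l m * ((k == j)%:R - N * (ui k x * ui j x) / w x)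
   + eigen x * (- N * ((hess u k m x * ui j x + ui k x * hess u j m x) / w x
        - ui k x * ui j x / w x ^+ 2 * (2 * (eigen x * (1 - N)) * ui m x)))).
  have nz : w x != 0 by rewrite gt_eqF // w0.
  have gR := hasgradM gl (hasgradB (hasgrad_cst ((k == j)%:R) x)
    (hasgradM (hasgradZ N (hasgradM (gui k Ex) (gui j Ex))) (hasgradV nz (gw Ux)))).
  have e : \forall y \near x, eigen y * ((k == j)%:R - N * (ui k y * ui j y) / w y) = hess u k j y.
    by apply: (near_open oU Ux) => y Uy; rewrite hess_eigen.
  apply: (hasgrad_eq (hasgrad_near e gR)) => m.
  rewrite -/(l m); move: (l m) (eigen x) (ui k x) (ui j x) (ui m x) (hess u k m x) (hess u j m x).
  move: (w x) nz ((k == j)%:R) => W W0 d l1 e1 a b c h1 h2.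
  by field.
have tr j : l j = N * ui j x / w x * (\sum_k l k * ui k x + (N - 1) * eigen x ^+ 2).
  have := hess_diff_trace hu j Ex.
  rewrite (eq_bigr (fun k => (j == k)%:R * l k - N * ui j x / w x * (l k * ui k x)
    + (- (eigen x * N * ui j x / w x) * hess u k k x
    - eigen x * N / w x * (hess u j k x * ui k x)
    + 2 * N * eigen x ^+ 2 * (1 - N) * ui j x / w x ^+ 2 * ui k x ^+ 2))); last first.
    move=> k _; rewrite (gF k j).2 [j == k]eq_sym.
    move: (l k) (eigen x) (ui k x) (ui j x) (hess u k k x) (hess u j k x).
    move: (w x) (w0 Ux) ((k == j)%:R) => W W0 d l1 e1 a b h1 h2.
    by field; rewrite gt_eqF.
  rewrite !big_split /= !sumrN sum_delta -!mulr_sumr (hess_trace hu Ex) -/(B j x) B_eigen //.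
  rewrite -/(w x).
  move: (w x) (w0 Ux) (l j) (\sum_k l k * ui k x) (eigen x) (ui j x) => W W0 l1 L e1 a h.
  rewrite -[LHS]subr0 -h; field.
  by rewrite gt_eqF.
have L : \sum_k l k * ui k x = - N * eigen x ^+ 2.
  have : \sum_k l k * ui k x = N * (\sum_k l k * ui k x + (N - 1) * eigen x ^+ 2).
    rewrite [LHS](eq_bigr (fun k =>
        N / w x * (\sum_k l k * ui k x + (N - 1) * eigen x ^+ 2) * ui k x ^+ 2)).
      rewrite -mulr_sumr -/(w x).
      move: (w x) (w0 Ux) (\sum_k l k * ui k x) (eigen x) => W W0 L e1.
      by field; rewrite gt_eqF.
    move=> k _; rewrite tr.
    move: (w x) (\sum_k l k * ui k x) (eigen x) (ui k x) => W L e1 a; ring.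
  move: (\sum_k l k * ui k x) (eigen x) N1 => L e1 N1' h.
  apply: (@mulfI _ (N - 1)); first by rewrite gt_eqF.
  rewrite -[LHS]subr0 -(subrr L) {2}h; ring.
rewrite -/(l i) tr L.
move: (w x) (eigen x) (ui i x) => W e1 a; ring.
Qed.

(* For u = a |x - p|^(2 - n) + b, the functions [integralQ], [centre] and
   [offset] are the constants ((n - 2) a)^(-2), p and b. *)
Definition integralQ x := eigen x ^+ (2 * n.-1) / w x ^+ n.

Let powk (k : nat) (f : 'rV[R]_n -> R) x (m : R) (g : 'I_n -> R) :
  hasgrad f x (fun i => m * f x * g i) ->
  hasgrad (fun y => f y ^+ k) x (fun i => k%:R * m * f x ^+ k * g i).
Proof.
move=> h; apply: (hasgrad_eq (hasgradX k h)) => i.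
case: k => [|k] /=; first by rewrite !mul0r.
rewrite exprS; move: (f x ^+ k) (k.+1%:R) => s t; ring.
Qed.

Lemma grad_integralQ x : U x -> hasgrad integralQ x (fun=> 0).
Proof.
move=> Ux.
have nz : w x ^+ n != 0 by rewrite expf_neq0 // gt_eqF // w0.
have g1 : hasgrad eigen x (fun i => - N * eigen x * (eigen x / w x * ui i x)).
  apply: (hasgrad_eq (grad_eigen Ux)) => i.
  by move: (w x) (eigen x) (ui i x) => W e1 a; ring.
have g2 : hasgrad w x (fun i => 2 * (1 - N) * w x * (eigen x / w x * ui i x)).
  apply: (hasgrad_eq (gw Ux)) => i.
  move: (w x) (w0 Ux) (eigen x) (ui i x) => W W0 e1 a.
  by field; rewrite gt_eqF.
have gQ := hasgradM (powk (2 * n.-1) g1) (hasgradV nz (powk n g2)).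
apply: (hasgrad_eq gQ) => i.
have -> : (2 * n.-1)%:R = 2 * (N - 1) :> R.
  by rewrite natrM -subn1 natrB // ltnW // ltnW.
rewrite -/N; move: nz; move: (w x ^+ n) (eigen x ^+ _) (eigen x / w x * ui i x) => W e1 a W0.
by field.
Qed.

Definition centre i x := x ord0 i - ui i x / eigen x.

Lemma grad_centre i x : U x -> eigen x != 0 -> hasgrad (centre i) x (fun=> 0).
Proof.
move=> Ux e0.
have gP := hasgradB (hasgrad_coord x i) (hasgradM (gui i (UE Ux)) (hasgradV e0 (grad_eigen Ux))).
apply: (hasgrad_eq gP) => j; rewrite hess_eigen //.
move: ((i == j)%:R) (w x) (w0 Ux) (eigen x) e0 (ui i x) (ui j x) => d W W0 e1 e0 a b.
by field; rewrite e0 gt_eqF.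
Qed.

Definition offset x := u x + w x / ((N - 2) * eigen x).

Lemma grad_offset x : U x -> eigen x != 0 -> hasgrad offset x (fun=> 0).
Proof.
move=> Ux e0.
have nz : (N - 2) * eigen x != 0 by rewrite mulf_neq0 // gt_eqF.
have gP := hasgradD (hasgrad_u hu (UE Ux))
  (hasgradM (gw Ux) (hasgradV nz (hasgradZ (N - 2) (grad_eigen Ux)))).
apply: (hasgrad_eq gP) => j; rewrite -/(ui j x).
move: (w x) (w0 Ux) (eigen x) e0 (ui j x) => W W0 e1 e0 b.
by field; rewrite e0 !gt_eqF.
Qed.

End FirstIntegrals.

Section Rigidity.
Variables (R : realType) (n : nat) (Omega : set 'rV[R]_n) (u : 'rV[R]_n -> R).
Hypothesis n3 : (3 <= n)%N.
Hypothesis hOmega : bounded_domain Omega.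
Hypothesis sOmega : smooth_boundary Omega.
Hypothesis hu : electrostatic_potential Omega u.
Let E := ~` closure Omega.
Hypothesis cE : connected E.
Let U := ~` (closure Omega `|` Crit u).
Hypothesis D0 : forall x, U x -> deficit u x = 0.
Implicit Types (x y z p : 'rV[R]_n).

Let N : R := n%:R.
Let w x := \sum_i partial i u x ^+ 2.
Let lam := eigen u.
Let Q := integralQ u.

Let oO : open Omega. Proof. by case: hOmega. Qed.
Let bO : bounded_set Omega. Proof. by case: hOmega. Qed.
Let oE : open E. Proof. exact: exterior_open. Qed.
Let oU : open U. Proof. exact: (regular_open hu). Qed.
Let UE x : U x -> E x. Proof. by move=> /regularP[]. Qed.
Let w0 x : U x -> 0 < w x. Proof. exact: regular_gt0. Qed.
Let n0 : (0 < n)%N. Proof. by rewrite (leq_trans _ n3). Qed.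
Let N2 : 0 < N - 2. Proof. by rewrite subr_gt0 ltr_nat. Qed.
Let i0 : 'I_n := Ordinal n0.
Let e0 : 'rV[R]_n := delta_mx ord0 i0.

Let sqnorm_e0 : sqnorm e0 = 1.
Proof.
rewrite /sqnorm (bigD1 i0) //= mxE !eqxx expr1n big1 ?addr0 // => j /negPf ji.
by rewrite mxE ji andbF expr0n.
Qed.

Let e0_neq0 : e0 != 0.
Proof. by rewrite -sqnorm_eq0 sqnorm_e0 oner_eq0. Qed.

Let boundary_point : exists x, boundary Omega x.
Proof.
have [_ [y Oy] _ _] := hOmega.
by have [t _ bt] := ray_exit oO bO Oy e0_neq0; exists (t *: e0 + y).
Qed.

Let grad_not_constant (v : 'rV[R]_n) :
  ~ (forall x, E x -> forall i, partial i u x = v ord0 i).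
Proof.
move=> hv.
pose f x := u x - \sum_i v ord0 i * x ord0 i.
have gf x : E x -> hasgrad f x (fun=> 0).
  move=> Ex; apply: (hasgrad_eq (hasgradB (hasgrad_u hu Ex)
    (hasgrad_sum (index_enum _) predT (fun i => hasgradZ (v ord0 i) (hasgrad_coord x i))))) => j.
  rewrite hv // (eq_bigr (fun i => (j == i)%:R * v ord0 i)) ?sum_delta ?subrr // => i _.
  by rewrite eq_sym mulrC.
have [M hM] := exterior_far bO.
have [t0 [_ ht0 _]] := ray_far 0 M e0_neq0.
have fc x : E x -> f x = f (t0 *: e0 + 0).
  by move=> Ex; apply: (connected_constant oE cE gf) => //; exact: hM.
move: (f (t0 *: e0 + 0)) fc => c fc.
have [v0|v0] := eqVneq v 0.
  have uc x : E x -> u x = c.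
    move=> /fc; rewrite /f big1 ?subr0 // => i _.
    by rewrite v0 mxE mul0r.
  have c0 : c = 0.
    apply/eqP; rewrite -normr_le0 leNgt; apply/negP => cp.
    have [M1 hM1] := potential_far bO hu cp.
    have [t1 [_ ht1 _]] := ray_far 0 M1 e0_neq0.
    by have [/uc -> ] := hM1 _ ht1; rewrite ltxx.
  have [x bx] := boundary_point.
  have [g [D [cg gx clD DE ug]]] := potential_boundary_limit oO sOmega hu bx.
  have : g x = 0.
    apply: (closure_continuous_eq clD cg) => y Dy.
    by rewrite -ug // uc ?c0 //; exact: DE.
  by rewrite gx => /eqP; rewrite oner_eq0.
have [t [_ ht1 ht2]] := ray_far 0 (Num.max M (1 - c)) v0.
move: ht1 ht2; rewrite !gt_max => /andP[ht1 _] /andP[_ ht2].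
have Ex := hM _ ht1.
have := potential_le1 n0 oO hu (exterior_notin Ex).
have := fc _ Ex; rewrite /f.
have -> : \sum_i v ord0 i * (t *: v + 0) ord0 i = t * sqnorm v.
  rewrite /sqnorm mulr_sumr; apply: eq_bigr => i _.
  by rewrite addr0 mxE mulrCA expr2.
move: ht2; move: (t * _) (u _) => a b; lra.
Qed.

Let regular_point : exists x, U x.
Proof.
apply: contrapT => nU; apply: (@grad_not_constant 0) => x Ex i.
have gx : grad u x = 0.
  by apply: contrapT => nx; apply: nU; exists x; apply/regularP.
by rewrite -gx mxE.
Qed.

Let gQ x : U x -> hasgrad Q x (fun=> 0).
Proof. exact: (grad_integralQ n3 hu D0). Qed.

Let glam x : U x -> {for x, continuous lam}.
Proof. by move=> Ux; apply: differentiable_continuous; case: (grad_eigen n3 hu D0 Ux). Qed.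

Let gpart i x : E x -> {for x, continuous (partial i u)}.
Proof. by move=> Ex; apply: differentiable_continuous; case: (hasgrad_partial_u hu i Ex). Qed.

Let Q_eq0 x : U x -> (Q x == 0) = (lam x == 0).
Proof.
move=> Ux; rewrite /Q /integralQ mulf_eq0 invr_eq0 !expf_eq0.
rewrite -/(w x) (gt_eqF (w0 Ux)) andbF orbF muln_gt0 /= -ltnS prednK //.
by rewrite (ltn_trans _ n3).
Qed.

(* If [eigen] vanished somewhere, so would [integralQ], hence the Hessian, and
   Du would be constant. *)
Let lam_neq0 x0 : U x0 -> lam x0 != 0.
Proof.
move=> Ux0; apply/eqP => l0; apply: (@grad_not_constant (grad u x0)).
pose S := [set x | [/\ U x, lam x = 0 & forall i, partial i u x = partial i u x0]].
suff SE : S = E by move=> x; rewrite -SE => -[_ _ h] i; rewrite h mxE.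
apply: (connected_clopen cE).
- by move=> x [/UE].
- by exists x0.
- move=> x [Ux lx px]; have [e e_gt0 he] := open_ball_sub oU Ux.
  have hl y : `|x - y| < e -> lam y = 0.
    move=> xy; apply/eqP; rewrite -(Q_eq0 (he y xy)).
    by rewrite (ball_constant (fun t xt => gQ (he t xt)) xy) Q_eq0 ?lx.
  have hp i y : `|x - y| < e -> partial i u y = partial i u x0.
    move=> xy; rewrite -px; apply: (ball_constant _ xy) => z xz.
    apply: (hasgrad_eq (hasgrad_partial_u hu i (UE (he z xz)))) => j.
    by rewrite (hess_eigen n3 hu D0 i j (he z xz)) -/lam hl // mul0r.
  apply/nbhs_ballP; exists e; first exact: e_gt0.
  move=> y; rewrite -ball_normE => xy.
  by split; [exact: he|exact: hl|move=> i; exact: hp].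
- move=> y Ey cy.
  have py i : partial i u y = partial i u x0.
    by apply: (closure_continuous_eq cy (gpart Ey)) => z [].
  have Uy : U y.
    apply/regularP; split=> // gy; have [_ nx0] := (@regularP R n Omega u x0).1 Ux0.
    apply: nx0; apply/rowP => i; have := congr1 (fun v : 'rV[R]_n => v ord0 i) gy.
    by rewrite !mxE py.
  by split=> //; apply: (closure_continuous_eq cy (glam Uy)) => z [].
Qed.

Let centred p x := forall i, centre u i x = p ord0 i.

Let partial_centred p x i : U x -> centred p x ->
  partial i u x = lam x * (x - p) ord0 i.
Proof.
move=> Ux /(_ i) h; rewrite !mxE -h /centre -/lam.
move: (lam x) (lam_neq0 Ux) (x ord0 i) (partial i u x) => l l0 a b.
by field.
Qed.

Let w_centred p x : U x -> centred p x -> w x = lam x ^+ 2 * sqnorm (x - p).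
Proof.
move=> Ux cx; rewrite /sqnorm mulr_sumr; apply: eq_bigr => i _.
by rewrite (partial_centred i Ux cx) exprMn.
Qed.

Let Q_centred p x : U x -> centred p x -> Q x * w x * sqnorm (x - p) ^+ n.-1 = 1.
Proof.
move=> Ux cx; rewrite /Q /integralQ -/(w x) -/lam exprM.
have -> : w x ^+ n = w x * w x ^+ n.-1 by rewrite -exprS prednK.
have nz : w x ^+ n.-1 != 0 by rewrite expf_neq0 // gt_eqF // w0.
have e : lam x ^+ 2 ^+ n.-1 * sqnorm (x - p) ^+ n.-1 = w x ^+ n.-1.
  by rewrite -exprMn -(w_centred Ux cx).
have alg (l s W v : R) : W != 0 -> 0 < v -> l * s = W -> l / (v * W) * v * s = 1.
  move=> W0 v0 lsW; apply: (mulIf W0); rewrite mul1r -[RHS]lsW; field.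
  by rewrite W0 gt_eqF.
exact: (alg _ _ _ _ nz (w0 Ux) e).
Qed.

Lemma rigidity_centre : exists (p : 'rV[R]_n) (q : R), 0 < q /\
  forall x, E x -> [/\ U x, centred p x & Q x = q].
Proof.
have [x0 Ux0] := regular_point.
exists (\row_i centre u i x0), (Q x0); split.
  apply: divr_gt0; last exact: exprn_gt0 (w0 Ux0).
  by rewrite exprM exprn_gt0 // exprn_even_gt0 // orbC lam_neq0.
set p := \row_i _.
pose S := [set x | [/\ U x, centred p x & Q x = Q x0]].
suff SE : S = E by move=> x; rewrite -SE.
have gc i x : U x -> hasgrad (centre u i) x (fun=> 0).
  by move=> Ux; exact: (grad_centre n3 hu D0 i Ux (lam_neq0 Ux)).
apply: (connected_clopen cE).
- by move=> x [/UE].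
- by exists x0; split=> // i; rewrite mxE.
- move=> x [Ux cx Qx]; have [e e_gt0 he] := open_ball_sub oU Ux.
  apply/nbhs_ballP; exists e; first exact: e_gt0.
  move=> y; rewrite -ball_normE => xy.
  split; first exact: he.
    by move=> i; rewrite -cx; exact: (ball_constant (fun t xt => gc i t (he t xt)) xy).
  by rewrite -Qx; exact: (ball_constant (fun t xt => gQ (he t xt)) xy).
- move=> y Ey cy.
  have h : Q x0 * sqnorm (grad u y) * sqnorm (y - p) ^+ n.-1 = 1.
    pose F z := Q x0 * sqnorm (grad u z) * sqnorm (z - p) ^+ n.-1.
    apply: (@closure_continuous_eq R n S F 1 y cy).
      exact: (@continuous_at_mul R n (fun z => Q x0 * sqnorm (grad u z)) _ y
        (continuous_at_mul (@continuous_at_cst R n (Q x0) y) (sqnorm_grad_continuous hu Ey))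
        (@continuous_at_sqnormX R n p n.-1 y)).
    by move=> z [Uz cz Qz]; rewrite /F sqnorm_grad -Qz Q_centred.
  have Uy : U y.
    apply/regularP; split=> // gy; move: h; rewrite gy.
    have -> : sqnorm (0 : 'rV[R]_n) = 0 by apply/eqP; rewrite sqnorm_eq0.
    by rewrite mulr0 mul0r => /esym/eqP; rewrite oner_eq0.
  split; first exact: Uy.
    move=> i; apply: (closure_continuous_eq cy (differentiable_continuous (gc i y Uy).1)).
    by move=> z [_ cz _]; exact: cz.
  apply: (closure_continuous_eq cy (differentiable_continuous (gQ Uy).1)).
  by move=> z [].
Qed.

Lemma rigidity_potential : exists (p : 'rV[R]_n) (K : R), 0 < K /\
  forall x, E x -> K * u x ^+ 2 * sqnorm (x - p) ^+ n.-2 = 1.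
Proof.
have [p [q [q0 hE]]] := rigidity_centre.
pose K := (N - 2) ^+ 2 * q.
have K0 : 0 < K by rewrite mulr_gt0 // exprn_gt0.
have go x : E x -> hasgrad (offset u) x (fun=> 0).
  by move=> /hE [Ux _ _]; exact: (grad_offset n3 hu D0 Ux (lam_neq0 Ux)).
have [M hM] := exterior_far bO.
have [t0 [_ ht0 _]] := ray_far 0 M e0_neq0.
have oc x : E x -> offset u x = offset u (t0 *: e0 + 0).
  by move=> Ex; apply: (connected_constant oE cE go) => //; exact: hM.
move: (offset u (t0 *: e0 + 0)) oc => b oc.
have Kb x : E x -> K * (b - u x) ^+ 2 * sqnorm (x - p) ^+ n.-2 = 1.
  move=> Ex; have [Ux cx Qx] := hE x Ex.
  have -> : b - u x = w x / ((N - 2) * lam x).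
    by rewrite -(oc x Ex) /offset addrAC subrr add0r.
  have e : ((N - 2) * lam x)^-1 ^+ 2 * (N - 2) ^+ 2 * w x = sqnorm (x - p).
    rewrite (w_centred Ux cx); move: (lam x) (lam_neq0 Ux) => l l0.
    by field; rewrite l0 gt_eqF.
  have h := Q_centred Ux cx; rewrite Qx in h; apply: etrans h.
  have nE : n.-1 = n.-2.+1 by rewrite prednK // -ltnS prednK // (ltn_trans _ n3).
  have -> : sqnorm (x - p) ^+ n.-1 = sqnorm (x - p) * sqnorm (x - p) ^+ n.-2.
    by rewrite -exprS -nE.
  rewrite -[X in _ = _ * (X * _)]e /K.
  move: (sqnorm _ ^+ n.-2) (_^-1) (w x) => s l W; ring.
exists p, K; split=> [//|x Ex]; rewrite -(Kb x Ex); congr (_ * _ * _).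
suff -> : b = 0 by rewrite sub0r sqrrN.
apply/eqP; rewrite -normr_le0 leNgt; apply/negP => b0.
have b2 : 0 < `|b| / 2 by rewrite divr_gt0.
have [M1 hM1] := potential_far bO hu b2.
have Kb0 : 0 < K * (`|b| / 2) ^+ 2 by rewrite mulr_gt0 // exprn_gt0.
have [t [t1 ht1 ht2]] := ray_far p (Num.max M1 (K * (`|b| / 2) ^+ 2)^-1) e0_neq0.
move: ht1 ht2; rewrite !gt_max sqnorm_e0 mulr1 => /andP[ht1 _] /andP[_ ht2].
have [Ey uy] := hM1 _ ht1.
have := Kb _ Ey; rewrite addrK sqnormZ sqnorm_e0 mulr1 => h1.
have : 1 < K * (b - u (t *: e0 + p)) ^+ 2 * t ^+ 2 ^+ n.-2.
  have h2 : (`|b| / 2) ^+ 2 <= (b - u (t *: e0 + p)) ^+ 2.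
    rewrite -[leRHS]real_normK ?num_real // ler_pXn2r ?nnegrE ?(ltW b2) //.
    apply: le_trans (lerB_dist _ _).
    by move: uy; move: `|b| `|u _| => s r; lra.
  have h3 : t <= t ^+ 2 ^+ n.-2.
    rewrite -exprM -{1}(expr1 t) ler_weXn2l // muln_gt0 /=.
    by rewrite -ltnS -ltnS !prednK // -ltnS prednK // (ltn_trans _ n3).
  apply: (@lt_le_trans _ _ (K * (`|b| / 2) ^+ 2 * t)).
    by rewrite mulrC -ltr_pdivrMr // div1r.
  apply: ler_pM => //; first exact: ltW.
    by rewrite (le_trans ler01).
  by rewrite ler_wpM2l // ltW.
by rewrite h1 ltxx.
Qed.

Lemma rigidity : round_ball Omega.
Proof.
have [p [K [K0 hK]]] := rigidity_potential.
pose s x := sqnorm (x - p).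
have n2 : (0 < n.-2)%N.
  by rewrite -ltnS -ltnS !prednK // -ltnS prednK // (ltn_trans _ n3).
have Kbd x : boundary Omega x -> K * s x ^+ n.-2 = 1.
  move=> bx.
  have [g [D [cg gx clD DE ug]]] := potential_boundary_limit oO sOmega hu bx.
  have : K * g x ^+ 2 * s x ^+ n.-2 = 1.
    apply: (@closure_continuous_eq R n D (fun y => K * g y ^+ 2 * s y ^+ n.-2) 1 x clD).
      exact: (@continuous_at_mul R n (fun y => K * g y ^+ 2) _ x
        (continuous_at_mul (@continuous_at_cst R n K x) (continuous_at_mul cg cg))
        (@continuous_at_sqnormX R n p n.-2 x)).
    by move=> y Dy; rewrite -ug //; apply: hK; exact: DE.
  by rewrite gx expr1n mulr1.
have [x1 bx1] := boundary_point.
have s0 x : 0 <= s x by exact: sqnorm_ge0.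
have s1 : 0 < s x1.
  rewrite lt_neqAle s0 andbT eq_sym; apply/eqP => sz.
  by have /eqP := Kbd x1 bx1; rewrite sz expr0n gtn_eqF // mulr0 eq_sym oner_eq0.
have sbd x : boundary Omega x -> s x = s x1.
  move=> bx; apply/eqP; rewrite -(@eqrXn2 _ n.-2) //.
  by apply/eqP/(mulfI (lt0r_neq0 K0)); rewrite !Kbd.
have sE x : E x -> s x1 <= s x.
  move=> Ex; rewrite -(@ler_pXn2r _ n.-2) ?nnegrE //.
  rewrite -(ler_pM2l K0) (Kbd x1 bx1) -(hK x Ex) mulrAC ler_piMr //.
    by rewrite mulr_ge0 ?(ltW K0) // exprn_ge0 ?sqnorm_ge0.
  rewrite expr_le1 //; last by apply: (potential_ge0 n0 oO hu); exact: exterior_notin.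
  by apply: (potential_le1 n0 oO hu); exact: exterior_notin.
exists p, (Num.sqrt (s x1)); split; first by rewrite sqrtr_gt0.
have ballE x : (enorm (x - p) < Num.sqrt (s x1)) = (s x < s x1).
  by rewrite ltr_sqrt.
apply/seteqP; split=> x /=; rewrite ballE => hx; last first.
  apply: contrapT => nx; have [/sbd|/sE] := complement_cases oO nx.
    by move=> e; move: hx; rewrite e ltxx.
  by rewrite leNgt hx.
rewrite ltNge; apply/negP => sx.
have vn : x - p != 0.
  by rewrite -sqnorm_eq0 gt_eqF // (lt_le_trans s1).
have [t t0 /sbd] := ray_exit oO bO hx vn.
have -> : s (t *: (x - p) + x) = (1 + t) ^+ 2 * s x.
  rewrite /s -sqnormZ scalerDl scale1r; congr sqnorm.
  by rewrite -addrA addrC.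
move: (s x1) (s x) s1 sx => a b a0 ab h; have : b < (1 + t) ^+ 2 * b.
  by rewrite ltr_pMl ?(lt_le_trans a0) // -[ltLHS](expr1n _ 2) ltrXn2r // ltrDl.
by rewrite h ltNge ab.
Qed.

End Rigidity.

(* A shell such as {1 < |x| < 2} has u = 1 in its hole and u radial outside, so
   it gives equality without being a ball: in the implication from equality to
   roundness, Omega must have connected exterior. *)
Theorem theorem1p7 (R : realType) (n : nat) (Omega : set 'rV[R]_n)
    (u : 'rV[R]_n -> R) (beta c d : R)
    (hn : (3 <= n)%N)
    (hOmega : bounded_domain Omega)
    (hbd : smooth_boundary Omega)
    (hu : electrostatic_potential Omega u)
    (hbeta : 0 <= beta)
    (hcd : 0 <= c + d)
    (hd : 0 <= d) :
  (forall x, (~` (closure Omega `|` Crit u)) x ->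
     a_coef n beta * Ffun n beta c d (u x) * enorm (defect u x) ^+ 2
       * enorm (grad u x) `^ (beta - 4)
     <= divergence (flux beta c d u) x)
  /\
  ((n%:R - 2) / (n%:R - 1) <= beta ->
     (forall x, (~` (closure Omega `|` Crit u)) x ->
        0 <= enorm (grad u x) ^+ 2 * divergence (flux beta c d u) x)
     /\
     (~ (c = 0 /\ d = 0) ->
        (round_ball Omega ->
         forall x, (~` (closure Omega `|` Crit u)) x ->
           enorm (grad u x) ^+ 2 * divergence (flux beta c d u) x = 0)
        /\
        (connected (~` closure Omega) ->
         (forall x, (~` (closure Omega `|` Crit u)) x ->
            enorm (grad u x) ^+ 2 * divergence (flux beta c d u) x = 0) ->
         round_ball Omega))).
Proof.
have [oO _ _ _] := hOmega.
have F0 x : (~` (closure Omega `|` Crit u)) x -> 0 <= Ffun n beta c d (u x).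
  move=> /(regular_bounds hn oO hu)/andP[u0 u1].
  by apply: Ffun_ge0 => //; rewrite !ltW.
have E0 x : 0 <= enorm (grad u x) `^ (beta - 4) by exact: powR_ge0.
have R0 x : (~` (closure Omega `|` Crit u)) x ->
    0 <= beta * sqnorm (grad u x) * deficit u x.
  move=> Ux; rewrite mulr_ge0 ?mulr_ge0 ?sqnorm_ge0 //.
  exact: (deficit_ge0 hn hu Ux).
split=> [x Ux|hb].
  rewrite (divergence_fluxE hn oO hu beta c d Ux).
  move: (F0 x Ux) (E0 x) (R0 x Ux).
  move: (Ffun _ _ _ _ _) (_ `^ _) (beta * _ * _) (enorm (defect u x) ^+ 2) (a_coef n beta).
  move=> F e r t a Fge ege rge.
  by rewrite mulrDr -subr_ge0 (_ : _ - _ = F * e * r) ?mulr_ge0 //; ring.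
have n1 : 0 < n%:R - 1 :> R by rewrite subr_gt0 ltr1n ltnW.
have beta0 : 0 < beta.
  by apply: lt_le_trans hb; rewrite divr_gt0 // subr_gt0 ltr_nat.
have a0 : 0 <= a_coef n beta by rewrite mulr_ge0 ?divr_ge0 // subr_ge0.
split=> [x Ux|ncd].
  rewrite (divergence_fluxE hn oO hu beta c d Ux); apply: mulr_ge0 (sqr_ge0 _) _.
  apply: mulr_ge0 (mulr_ge0 (F0 x Ux) (E0 x)) _.
  exact: addr_ge0 (mulr_ge0 a0 (sqr_ge0 _)) (R0 x Ux).
split=> [[p [r [r0 OE]]] x Ux|cE hdiv].
  rewrite OE in hu Ux.
  by rewrite (ball_divergence_eq0 hn r0 hu beta c d Ux) mulr0.
apply: (rigidity hn hOmega hbd hu cE) => x Ux.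
have w0 : 0 < sqnorm (grad u x) by rewrite sqnorm_grad; exact: (regular_gt0 Ux).
have g0 : 0 < enorm (grad u x) by rewrite sqrtr_gt0.
have F1 := Ffun_gt0 n beta hcd hd ncd (regular_bounds hn oO hu Ux).
have := hdiv x Ux; rewrite (divergence_fluxE hn oO hu beta c d Ux) => /eqP.
rewrite enorm_sqr mulf_eq0 (gt_eqF w0) /= mulf_eq0.
rewrite (gt_eqF (mulr_gt0 F1 (powR_gt0 _ g0))) /=.
rewrite paddr_eq0 ?R0 //; last by rewrite mulr_ge0 // sqr_ge0.
by move=> /andP[_]; rewrite mulf_eq0 (gt_eqF (mulr_gt0 beta0 w0)) => /eqP.
Qed.
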